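(* For any $d\in\mathbb{N}$, $R>0$, any sufficiently small $\alpha,\varepsilon>0$ and all $m\in\mathbb{N}$, \[ n_m^{\mathrm{Gauss}(R,d;\alpha)}(\varepsilon,\delta=0)=\tilde{\Theta}\left(\frac{d}{\varepsilon}+\frac{d}{\alpha\varepsilon\sqrt{m}}+\frac{d}{\alpha^2 m}\right). \]
   Context: User-level DP: there are $n$ users each holding $m$ examples from a domain $\mathcal{Z}$; two inputs in $\mathcal{Z}^{nm}$ are user-level neighbors if they differ only in one user's $m$ examples; an algorithm is $(\varepsilon,\delta)$-user-level DP if $\Pr[\mathbf{A}(\mathbf{x})\in S]\le e^\varepsilon\Pr[\mathbf{A}(\mathbf{x}')\in S]+\delta$ for all neighbors and all output sets $S$. For a task with correct-answer sets $\Psi(\mathcal{D})$, $n_m(\varepsilon,\delta)$ is the smallest $n$ such that some $(\varepsilon,\delta)$-user-level DP algorithm, given $nm$ i.i.d. samples from $\mathcal{D}$ grouped into $n$ users, outputs an element of $\Psi(\mathcal{D})$ with probability at least $2/3$ for every valid $\mathcal{D}$. The task $\mathrm{Gauss}(R,d;\alpha)$: $\mathcal{Z}=\mathbb{R}^d$, the valid distributions are Gaussians $\mathcal{N}(\mu,I)$ with $\mu\in\mathbb{R}^d$, $\|\mu\|\le R$, and a correct output is a distribution $\mathcal{Q}$ with $d_{\mathrm{TV}}(\mathcal{Q},\mathcal{D})\le\alpha$. $\tilde{\Theta}$ hides factors polylogarithmic in $1/\alpha$, $d$, $R$ (and other relevant parameters). *)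

(* Defs.v *)
From HB Require Import structures.
From mathcomp Require Import all_boot all_order all_algebra.
From mathcomp Require Import all_classical all_reals all_analysis.

Set Implicit Arguments.
Unset Strict Implicit.
Unset Printing Implicit Defensive.

Import Order.TTheory GRing.Theory Num.Theory.
Import numFieldNormedType.Exports.

Local Open Scope classical_set_scope.
Local Open Scope ring_scope.

Section product_probability.
Context {d : measure_display} {T : measurableType d} {R : realType}.

Definition tuple_cons (n : nat) (x : T * n.-tuple T) : n.+1.-tuple T :=
  [tuple of x.1 :: x.2].

Lemma measurable_tuple_cons (n : nat) :
  measurable_fun [set: T * n.-tuple T] (@tuple_cons n).
Proof. exact: measurable_cons. Qed.

HB.instance Definition _ (n : nat) :=
  isMeasurableFun.Build _ _ (T * n.-tuple T)%type (n.+1.-tuple T)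
    (@tuple_cons n) (@measurable_tuple_cons n).

(* The law of n independent coordinates, the i-th one distributed as P i. *)
Fixpoint tuple_prob (n : nat) :
    ('I_n -> probability T R) -> probability (n.-tuple T) R :=
  match n with
  | 0 => fun=> \d_([tuple] : 0.-tuple T)
  | n'.+1 => fun P =>
      distribution (P ord0 \x tuple_prob (fun i : 'I_n' => P (lift ord0 i)))%E
        (@tuple_cons n')
  end.

Lemma tuple_prob_box (n : nat) (P : 'I_n -> probability T R)
    (A : 'I_n -> set T) : (forall i, measurable (A i)) ->
  tuple_prob P [set x | forall i, A i (tnth x i)] =
  (\prod_(i < n) P i (A i))%E.
Proof.
elim: n P A => [|n IH] P A mA.
  by rewrite big_ord0 /= diracE mem_set//= => -[].
rewrite big_ord_recl /= /distribution /pushforward.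
rewrite [X in (_ \x _)%E X](_ : _ =
    A ord0 `*` [set x | forall i, A (lift ord0 i) (tnth x i)]); last first.
  apply/seteqP; split=> -[x y]/=.
    move=> h; split; first exact: (h ord0).
    by move=> i; have := h (lift ord0 i); rewrite tnthS.
  move=> [h0 h] i; case: (unliftP ord0 i) => [j ->|->]; last exact: h0.
  by rewrite tnthS; exact: h.
rewrite product_measure1E//; first by rewrite -IH.
rewrite (_ : mkset _ =
    \bigcap_(i in setT) ((@tnth n T)^~ i @^-1` A (lift ord0 i))).
  apply: fin_bigcap_measurable => // i _.
  by rewrite -[X in measurable X]setTI; apply: measurable_tnth.
by apply/seteqP; split=> x h i; [move=> _|]; apply: h.
Qed.

Definition iid_prob (n : nat) (P : probability T R) :
    probability (n.-tuple T) R :=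
  tuple_prob (fun _ : 'I_n => P).

Definition tv_dist (P Q : probability T R) : \bar R :=
  ereal_sup [set `|P A - Q A|%E | A in measurable].

End product_probability.

Section user_level_privacy.
Context {R : realType} {dZ dY : measure_display}
  {Z : measurableType dZ} {Y : measurableType dY}.

(* x : n.-tuple (m.-tuple Z) groups nm examples into n users: tnth x i is the
   tuple of the m examples of user i. *)
Definition user_neighbors (n m : nat) (x x' : n.-tuple (m.-tuple Z)) : Prop :=
  exists i : 'I_n, forall j : 'I_n, j != i -> tnth x j = tnth x' j.

Definition user_level_DP (n m : nat) (eps delta : R)
    (A : R.-pker (n.-tuple (m.-tuple Z)) ~> Y) : Prop :=
  forall x x', user_neighbors x x' ->
  forall S : set Y, measurable S ->
    (A x S <= (expR eps)%:E * A x' S + delta%:E)%E.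

Record task := Task {
  valid : set (probability Z R) ;
  correct : probability Z R -> set Y }.

(* As a library measure takes unspecified values on non-measurable sets, "the
   output is in correct D with probability at least 2/3" is stated by means of a
   measurable subset E of correct D; this is the same as taking E := correct D
   when that set is measurable. *)
Definition solves (n m : nat) (t : task)
    (A : R.-pker (n.-tuple (m.-tuple Z)) ~> Y) : Prop :=
  forall D : probability Z R, valid t D ->
  exists E : set Y, [/\ measurable E, E `<=` correct t D &
    ((2 / 3)%:E <= \int[iid_prob n (iid_prob m D)]_x A x E)%E].

(* The smallest sufficient number of users; +oo when no number suffices. *)
Definition user_complexity (t : task) (m : nat) (eps delta : R) : \bar R :=
  ereal_inf [set n%:R%:E | n in [set n : nat |
    exists A : R.-pker (n.-tuple (m.-tuple Z)) ~> Y,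
      user_level_DP eps delta A /\ solves t A]].

End user_level_privacy.

Arguments task R {dZ dY} Z Y.

Section gaussian_task.
Context {R : realType}.

Definition l2norm (d : nat) (x : d.-tuple R) : R :=
  Num.sqrt (\sum_(i < d) tnth x i ^+ 2).

(* N(mu, I): the coordinates are independent, the i-th one is N(mu_i, 1). *)
Definition gaussian (d : nat) (mu : d.-tuple R) :
    probability (d.-tuple (measurableTypeR R)) R :=
  tuple_prob (fun i => normal_prob (tnth mu i) 1).

(* The outputs are themselves distributions on R^d; pprobability carries the
   sigma-algebra generated by the evaluations Q |-> Q A, A measurable. *)
Definition Gauss (r : R) (d : nat) (alpha : R) :
    task R (d.-tuple (measurableTypeR R))
      (pprobability (d.-tuple (measurableTypeR R)) R) :=
  Task
    [set gaussian mu | mu in [set mu : d.-tuple R | l2norm mu <= r]]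
    (fun D => [set Q : pprobability (d.-tuple (measurableTypeR R)) R |
       (tv_dist (Q : probability _ R) D <= alpha%:E)%E]).

End gaussian_task.

(* f = Theta~(g) up to the constant C and the k-th power of the logarithm of the
   hidden parameters, of which s is the sum. *)
Definition theta_tilde {R : realType} (C : R) (k : nat) (s : R)
    (f : \bar R) (g : R) : Prop :=
  ((g / (C * ln (2 + s) ^+ k))%:E <= f /\
   f <= (C * ln (2 + s) ^+ k * g)%:E)%E.

(* Main.v *)
(* Lower bound. Among the 16^d Gaussians centred at the points of the grid
   {0, s, ..., 15 s}^d, with s proportional to alpha / sqrt d, at most 4^d are within
   reach of one output, so on data centred at the origin the algorithm hits the
   target of some grid point with probability at most 4^-d, whereas it hits it with
   probability 2/3 on data centred at that point. Exchanging the data of one user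
   multiplies the hitting probability by at most exp eps (privacy), by at most
   1 + k, where 1 + k is the chi-square moment between the laws of one user, and
   by at most 1 + O(eps sqrt k) (privacy makes the probability vary little with the
   data of one user, so only its fluctuations are affected). The three estimates
   yield the three terms.

   Upper bound. The candidates form a grid of step alpha / (100 sqrt d). Each ordered
   pair (j, l) of candidates has a test: every user reports the rescaled mean of its
   sample, recentred at j, in the direction from j to l, clipped to a bounded
   interval. A candidate that is far from the true mean scores higher against a
   candidate j0 near the true mean than j0 does against anyone, by a margin linear in
   the number of users. The exponential mechanism on the scores is private, and its
   failure probability is bounded by a union over pairs of moment generating
   functions, which factorize over the users. *)

From HB Require Import structures.
Require Import Defs.
From mathcomp Require Import all_boot all_order all_algebra.
From mathcomp Require Import all_classical all_reals all_analysis.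
From mathcomp Require Import measurable_realfun ring lra zify.

Set Implicit Arguments.
Unset Strict Implicit.
Unset Printing Implicit Defensive.

Import Order.TTheory GRing.Theory Num.Theory.
Import numFieldNormedType.Exports.

Local Open Scope classical_set_scope.
Local Open Scope ring_scope.

(** * Integrals against product and Gaussian laws *)

(** All three terms of the upper bound come from one expression. A user moves a test by about
    [t = min(alpha * sqrt m, 1)], and an exponential moment at a rate [s] at most proportional to
    [t] decays by about [s * t] per user; privacy also caps [s] at about [eps]. The logarithm of the
    number of candidates is of order [d] up to a logarithmic factor, so about
    [d * log / (t * min(eps, t))] users suffice, and expanding the two minima gives the three terms.
    Two devices keep the analysis elementary. Chi-square moments enter only through the
    Cauchy-Schwarz inequality that they imply, which tensorizes by Tonelli without densities on
    product spaces. Nor is the law of a user's statistic ever computed: its shift with the mean, its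
    symmetry and one exponential moment are enough. The condition [alpha <= c * r] serves the lower
    bound: the packing has a diameter proportional to [alpha] and must fit in the ball of admissible
    means. *)

Lemma integral_prob_cst {d : measure_display} {T : measurableType d}
    {R : realType} (P : probability T R) (c : \bar R) :
  (\int[P]_x c = c)%E.
Proof. by rewrite integral_cst// [X in (_ * X)%E]probability_setT mule1. Qed.

Section tuple_integrals.
Local Open Scope ereal_scope.
Context {d : measure_display} {T : measurableType d} {R : realType}.

Lemma tuple_prob_integralS (n : nat) (P : 'I_n.+1 -> probability T R)
    (f : n.+1.-tuple T -> \bar R) :
  measurable_fun [set: n.+1.-tuple T] f -> (forall x, 0 <= f x) ->
  \int[tuple_prob P]_x f x =
  \int[P ord0]_x \int[tuple_prob (fun i => P (lift ord0 i))]_y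
    f (tuple_cons (x, y)).
Proof.
move=> mf f0 /=; rewrite ge0_integral_distribution//.
rewrite fubini_tonelli1//; last by move=> x; exact: f0.
by apply: measurableT_comp => //; exact: measurable_tuple_cons.
Qed.

Lemma measurable_tuple_prob_section (n : nat) (P : 'I_n -> probability T R)
    (f : n.+1.-tuple T -> \bar R) :
  measurable_fun [set: n.+1.-tuple T] f -> (forall x, 0 <= f x) ->
  measurable_fun [set: T] (fun x => \int[tuple_prob P]_y f (tuple_cons (x, y))).
Proof.
move=> mf f0.
have := @measurable_fun_fubini_tonelli_F _ _ T (n.-tuple T) R (tuple_prob P)
  (f \o @tuple_cons _ _ n).
apply => //; first exact: measurableT_comp.
by move=> x; exact: f0.
Qed.

Lemma tnth_tuple_cons0 (n : nat) (x : T) (y : n.-tuple T) :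
  tnth (tuple_cons (x, y)) ord0 = x.
Proof. by []. Qed.

Lemma tnth_tuple_consS (n : nat) (x : T) (y : n.-tuple T) (i : 'I_n) :
  tnth (tuple_cons (x, y)) (lift ord0 i) = tnth y i.
Proof. by rewrite tnthS. Qed.

Lemma measurable_tuple_cons2 (n : nat) (x : T) :
  measurable_fun [set: n.-tuple T] (fun y => tuple_cons (x, y)).
Proof. by apply: measurable_cons => //; exact: measurable_id. Qed.

Lemma integral_tuple_prod (n : nat) (P : 'I_n -> probability T R)
    (g : 'I_n -> T -> R) :
  (forall i, measurable_fun [set: T] (g i)) -> (forall i x, (0 <= g i x)%R) ->
  \int[tuple_prob P]_x (\prod_(i < n) g i (tnth x i))%:E =
  \prod_(i < n) \int[P i]_x (g i x)%:E.
Proof.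
elim: n P g => [|n IH] P g mg g0.
  rewrite big_ord0; under eq_integral do rewrite big_ord0.
  exact: integral_prob_cst.
have mprod k (h : 'I_k -> T -> R) : (forall i, measurable_fun [set: T] (h i)) ->
    measurable_fun [set: k.-tuple T] (fun x => (\prod_(i < k) h i (tnth x i))%:E).
  move=> mh; apply/measurable_EFinP; apply: measurable_prod => i _.
  by apply: measurableT_comp => //; exact: measurable_tnth.
have p0 k (h : 'I_k -> T -> R) x : (forall i x, 0 <= h i x)%R ->
    0 <= (\prod_(i < k) h i (tnth x i))%:E.
  by move=> h0; rewrite lee_fin prodr_ge0.
rewrite tuple_prob_integralS//; [|exact: mprod|by move=> x; exact: p0].
rewrite big_ord_recl -IH//.
rewrite -ge0_integralZr//; first last.
- by apply: integral_ge0 => x _; rewrite lee_fin prodr_ge0.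
- by move=> x _; rewrite lee_fin.
- exact/measurable_EFinP.
apply: eq_integral => x _.
under eq_integral.
  move=> y _; rewrite big_ord_recl EFinM tnth_tuple_cons0.
  under eq_bigr do rewrite tnth_tuple_consS.
  over.
rewrite ge0_integralZl//=.
- exact: (mprod _ (fun i => g (lift ord0 i))).
- by move=> y _; rewrite lee_fin prodr_ge0.
- by rewrite lee_fin.
Qed.

End tuple_integrals.

Section equal_laws.
Local Open Scope ereal_scope.
Context {R : realType}.

(** Nonnegative test functions allow Tonelli without integrability conditions, and the two variables
    may live on different spaces. *)
Definition same_law {d d' : measure_display} {T : measurableType d}
    {T' : measurableType d'} (P : probability T R) (X : T -> R)
    (Q : probability T' R) (Y : T' -> R) : Prop :=
  forall h : R -> \bar R, measurable_fun [set: R] h -> (forall z, 0 <= h z) ->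
    \int[P]_x h (X x) = \int[Q]_y h (Y y).

Lemma measurable_tuple_sum {d : measure_display} {T : measurableType d}
    (n : nat) (X : 'I_n -> T -> R) :
  (forall i, measurable_fun [set: T] (X i)) ->
  measurable_fun [set: n.-tuple T] (fun x => (\sum_(i < n) X i (tnth x i))%R).
Proof.
move=> mX; apply: measurable_sum => i.
by apply: measurableT_comp => //; exact: measurable_tnth.
Qed.

(** Integrating out the tail turns [h] into a test function [H] of the first variable alone; once
    that variable is exchanged, a translate [hx] of [h] is a test function for the tail. *)
Lemma same_law_sum {d d' : measure_display} {T : measurableType d}
    {T' : measurableType d'} (n : nat)
    (P : 'I_n -> probability T R) (X : 'I_n -> T -> R)
    (Q : 'I_n -> probability T' R) (Y : 'I_n -> T' -> R) :
  (forall i, measurable_fun [set: T] (X i)) ->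
  (forall i, measurable_fun [set: T'] (Y i)) ->
  (forall i, same_law (P i) (X i) (Q i) (Y i)) ->
  same_law (tuple_prob P) (fun x => \sum_(i < n) X i (tnth x i))%R
           (tuple_prob Q) (fun y => \sum_(i < n) Y i (tnth y i))%R.
Proof.
elim: n P X Q Y => [|n IH] P X Q Y mX mY PQ h mh h0.
  under eq_integral do rewrite big_ord0.
  under [RHS]eq_integral do rewrite big_ord0.
  by rewrite (integral_prob_cst (tuple_prob P)) (integral_prob_cst (tuple_prob Q)).
rewrite tuple_prob_integralS//; last first.
  apply: (@measurableT_comp _ _ _ _ _ _ h) => //.
  by have := measurable_tuple_sum mX.
rewrite tuple_prob_integralS//; last first.
  apply: (@measurableT_comp _ _ _ _ _ _ h) => //.
  by have := measurable_tuple_sum mY.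
pose H (z : R) :=
  \int[tuple_prob (fun i => P (lift ord0 i))]_y
    h (z + \sum_(i < n) X (lift ord0 i) (tnth y i))%R.
have mH : measurable_fun [set: R] H.
  apply: (@measurable_fun_fubini_tonelli_F _ _ R (n.-tuple T) R _
    (fun p => h (p.1 + \sum_(i < n) X (lift ord0 i) (tnth p.2 i))%R)) => //.
  apply: measurableT_comp => //; apply: measurable_funD => //.
  have ms : measurable_fun [set: n.-tuple T]
      (fun y => \sum_(i < n) X (lift ord0 i) (tnth y i))%R.
    by have := measurable_tuple_sum (fun i => mX (lift ord0 i)).
  exact: (measurableT_comp ms).
transitivity (\int[P ord0]_x H (X ord0 x)).
  apply: eq_integral => x _; apply: eq_integral => y _.
  rewrite big_ord_recl tnth_tuple_cons0.
  by under eq_bigr do rewrite tnth_tuple_consS.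
rewrite (PQ ord0)//; last by move=> z; apply: integral_ge0.
apply: eq_integral => x _.
pose hx z := h (Y ord0 x + z)%R.
transitivity (\int[tuple_prob (fun i => Q (lift ord0 i))]_y
   hx (\sum_(i < n) Y (lift ord0 i) (tnth y i))%R).
  apply: (IH (fun i => P (lift ord0 i)) (fun i => X (lift ord0 i))
    (fun i => Q (lift ord0 i)) (fun i => Y (lift ord0 i)) _ _ _ hx) => //.
    by rewrite /hx; apply: measurableT_comp => //; exact: measurable_funD.
  by move=> z; exact: h0.
apply: eq_integral => y _.
rewrite /hx big_ord_recl tnth_tuple_cons0.
by under [in RHS]eq_bigr do rewrite tnth_tuple_consS.
Qed.

End equal_laws.

Section normal_integrals.
Local Open Scope ereal_scope.
Context {R : realType}.
Local Notation mu := (@lebesgue_measure R).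
Implicit Types a b v : R.

Import HBNNSimple.

Let integral_normal_indic a (E : set (measurableTypeR R)) : measurable E ->
  \int[normal_prob a 1]_x (\1_E x)%:E =
  \int[mu]_x ((\1_E x)%:E * (normal_pdf a 1 x)%:E).
Proof.
move=> mE; rewrite integral_indic// setIT /normal_prob/=.
rewrite [LHS]integral_mkcond; apply: eq_integral => x _ /=.
by rewrite patchE indicE; case: ifP => _; rewrite ?mul1e ?mul0e.
Qed.

Let integral_normal_nnsfun a (f : {nnsfun (measurableTypeR R) >-> R}) :
  \int[normal_prob a 1]_x (f x)%:E =
  \int[mu]_x ((f x)%:E * (normal_pdf a 1 x)%:E).
Proof.
under [LHS]eq_integral do rewrite fimfunE -fsumEFin//.
rewrite [LHS]ge0_integral_fsum//; last 2 first.
  - by move=> r; exact/measurable_EFinP/measurableT_comp.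
  - by move=> n x _; rewrite EFinM nnfun_muleindic_ge0.
under [RHS]eq_integral.
  move=> x xD; rewrite fimfunE -fsumEFin// ge0_mule_fsuml; last first.
    by move=> r; rewrite EFinM nnfun_muleindic_ge0.
  over.
rewrite [RHS]ge0_integral_fsum//; last 2 first.
  - move=> r; apply: emeasurable_funM.
      by apply/measurable_EFinP; exact/measurableT_comp.
    by apply/measurable_EFinP; exact: measurable_normal_pdf.
  - move=> n x _; rewrite mule_ge0//; last by rewrite lee_fin normal_pdf_ge0.
    by rewrite EFinM nnfun_muleindic_ge0.
apply: eq_fsbigr => r _.
rewrite integralZl_indic_nnsfun//= integral_normal_indic//.
have [r0|r0] := leP 0%R r.
  rewrite -ge0_integralZl//=.
  - by apply: eq_integral => x _; rewrite EFinM muleA.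
  - apply: emeasurable_funM; first exact/measurable_EFinP/measurable_indic.
    by apply/measurable_EFinP; exact: measurable_normal_pdf.
  - by move=> x _; rewrite mule_ge0// lee_fin ?normal_pdf_ge0.
have -> : f @^-1` [set r] = set0 by exact: preimage_nnfun0.
rewrite !integral0_eq ?mule0// => x _; rewrite indicE in_set0 ?mulr0 ?mul0e//.
Qed.

Lemma integral_normal_prob a (f : R -> \bar R) :
  measurable_fun [set: R] f -> (forall x, 0 <= f x) ->
  \int[normal_prob a 1]_x f x = \int[mu]_x (f x * (normal_pdf a 1 x)%:E).
Proof.
move=> mf f0.
pose f_ := nnsfun_approx (measurableT : measurable [set: measurableTypeR R]) mf.
have mp : measurable_fun [set: measurableTypeR R]
    (fun x => (normal_pdf a 1 x)%:E).
  by apply/measurable_EFinP; exact: measurable_normal_pdf.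
transitivity (limn (fun n => \int[normal_prob a 1]_x (f_ n x)%:E)).
  rewrite -monotone_convergence//=.
  - apply: eq_integral => x _; apply/esym/cvg_lim => //=.
    exact: cvg_nnsfun_approx.
  - by move=> n; exact/measurable_EFinP/measurable_funTS.
  - by move=> n x _; rewrite lee_fin.
  - by move=> x _ n k nk; rewrite lee_fin; exact/lefP/nd_nnsfun_approx.
transitivity (limn (fun n =>
    \int[mu]_x ((f_ n x)%:E * (normal_pdf a 1 x)%:E))).
  by congr (limn _); apply/funext => n; exact: integral_normal_nnsfun.
rewrite -monotone_convergence//=.
- apply: eq_integral => x _; apply/cvg_lim => //=.
  apply: cvgeZr => //; exact: cvg_nnsfun_approx.
- move=> n; apply: emeasurable_funM => //.
  exact/measurable_EFinP/measurable_funTS.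
- by move=> n x _; rewrite mule_ge0// lee_fin ?normal_pdf_ge0.
- move=> x _ n k nk; rewrite lee_pmul2r//; last first.
    by rewrite lte_fin normal_pdfE ?oner_neq0// mulr_gt0 ?expR_gt0// normal_peak_gt0// oner_neq0.
  by rewrite lee_fin; exact/lefP/nd_nnsfun_approx.
Qed.

Lemma normal_pdf1E a x :
  normal_pdf a 1 x = (normal_peak 1 * expR (- ((x - a) ^+ 2 / 2)))%R.
Proof.
rewrite normal_pdfE ?oner_neq0//; congr (_ * expR _)%R.
by rewrite expr1n mulNr.
Qed.

Let normal_pdf_shift a b x : normal_pdf (a + b) 1 (x + b) = normal_pdf a 1 x.
Proof. by rewrite !normal_pdf1E (_ : x + b - (a + b) = x - a)%R//; ring. Qed.

Let normal_pdfN (x : R) : normal_pdf 0 1 (- x) = normal_pdf 0 1 x.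
Proof. by rewrite !normal_pdf1E !subr0 sqrrN. Qed.

Let measurable_mul_pdf a (f : R -> \bar R) : measurable_fun [set: R] f ->
  measurable_fun [set: measurableTypeR R] (fun x => f x * (normal_pdf a 1 x)%:E).
Proof.
move=> mf; apply: emeasurable_funM => //.
by apply/measurable_EFinP; exact: measurable_normal_pdf.
Qed.

Let mul_pdf_ge0 a (f : R -> \bar R) : (forall x, 0 <= f x) ->
  {in [set: measurableTypeR R], forall x, 0 <= f x * (normal_pdf a 1 x)%:E}.
Proof. by move=> f0 x _; rewrite mule_ge0// lee_fin normal_pdf_ge0. Qed.

Let lebesgue_measureD b (A : set (measurableTypeR R)) : measurable A ->
  mu A = pushforward mu (fun x : measurableTypeR R => (x + b)%R : measurableTypeR R) A.
Proof.
have mphi : measurable_fun [set: measurableTypeR R]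
   (fun x : measurableTypeR R => (x + b)%R : measurableTypeR R).
  exact: (@measurable_funD _ R R setT id (cst b)).
move=> mA; apply: lebesgue_measure_unique => // _ [[u v] _ <-].
rewrite /= /pushforward.
have -> : (fun x : R => x + b)%R @^-1` `]u, v] = `](u - b)%R, (v - b)%R]%classic.
  apply/seteqP; split => x; rewrite /= !in_itv/= => /andP[h1 h2];
    apply/andP; split; lra.
rewrite !lebesgue_measure_itv/= !lte_fin ltrD2r; case: ifP => // _.
by rewrite -!EFinD; congr EFin; ring.
Qed.

Lemma integral_normal_shift a b (f : R -> \bar R) :
  measurable_fun [set: R] f -> (forall x, 0 <= f x) ->
  \int[normal_prob (a + b) 1]_x f x = \int[normal_prob a 1]_x f (x + b)%R.
Proof.
move=> mf f0.
have mfb : measurable_fun [set: R] (fun x => f (x + b)%R).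
  by apply: (measurableT_comp mf); exact: measurable_funD.
rewrite (integral_normal_prob _ mf f0).
rewrite (integral_normal_prob _ mfb (fun x => f0 _)).
have mphi : measurable_fun [set: measurableTypeR R]
   (fun x : measurableTypeR R => (x + b)%R : measurableTypeR R).
  exact: (@measurable_funD _ R R setT id (cst b)).
transitivity (\int[pushforward mu
    (fun x : measurableTypeR R => (x + b)%R : measurableTypeR R)]_x
    (f x * (normal_pdf (a + b) 1 x)%:E)).
  by apply: eq_measure_integral => A mA _; exact: lebesgue_measureD.
etransitivity.
  exact: (ge0_integral_pushforward mphi mu measurableT
    (measurable_mul_pdf (a + b)%R mf) (@mul_pdf_ge0 (a + b)%R f f0)).
by apply: eq_integral => x _ /=; rewrite normal_pdf_shift.
Qed.

Lemma integral_normalN (f : R -> \bar R) :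
  measurable_fun [set: R] f -> (forall x, 0 <= f x) ->
  \int[normal_prob 0 1]_x f (- x)%R = \int[normal_prob 0 1]_x f x.
Proof.
move=> mf f0.
have mfb : measurable_fun [set: R] (fun x => f (- x)%R).
  exact: (measurableT_comp mf).
rewrite (integral_normal_prob _ mf f0).
rewrite (integral_normal_prob _ mfb (fun x => f0 _)).
have mphi : measurable_fun [set: measurableTypeR R]
   (fun x : measurableTypeR R => (- x)%R : measurableTypeR R).
  exact: (@oppr_measurable R setT).
transitivity (\int[pushforward mu
    (fun x : measurableTypeR R => (- x)%R : measurableTypeR R)]_x
    (f x * (normal_pdf 0 1 x)%:E)); last first.
  by apply: eq_measure_integral => A mA _; exact: lebesgue_measureN.
apply/esym; etransitivity.
  exact: (ge0_integral_pushforward mphi mu measurableT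
    (measurable_mul_pdf 0%R mf) (@mul_pdf_ge0 0%R f f0)).
by apply: eq_integral => x _ /=; rewrite normal_pdfN.
Qed.

(** Completing the square: exponential tilting by [v] moves the mean to [v]. *)
Let expR_normal_pdf v x :
  (expR (v * x) * normal_pdf 0 1 x = expR (v ^+ 2 / 2) * normal_pdf v 1 x)%R.
Proof.
rewrite !normal_pdf1E mulrCA [RHS]mulrCA -!expRD.
by rewrite (_ : v * x + _ = v ^+ 2 / 2 + - ((x - v) ^+ 2 / 2))%R//; field.
Qed.

Lemma integral_normal_expR v :
  \int[normal_prob 0 1]_x (expR (v * x))%:E = (expR (v ^+ 2 / 2))%:E.
Proof.
have me : measurable_fun [set: R] (fun x => (expR (v * x))%:E).
  by apply/measurable_EFinP; apply: measurableT_comp => //; apply: measurable_funM.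
have e0 (x : R) : 0 <= (expR (v * x))%:E by rewrite lee_fin expR_ge0.
rewrite (integral_normal_prob _ me e0).
transitivity (\int[mu]_x ((expR (v ^+ 2 / 2))%:E * (normal_pdf v 1 x)%:E)).
  by apply: eq_integral => x _; rewrite -!EFinM expR_normal_pdf.
rewrite ge0_integralZl//=.
- by rewrite integral_normal_pdf mule1.
- by apply/measurable_EFinP; exact: measurable_normal_pdf.
- by move=> x _; rewrite lee_fin normal_pdf_ge0.
Qed.

End normal_integrals.

(** * Chi-square bounds *)

Section chi_square.
Local Open Scope ereal_scope.
Context {R : realType}.

(* [chi2_le P Q K] is the Cauchy-Schwarz form of "the density of P with respect
   to Q has second moment at most K". *)
Definition chi2_le {d : measure_display} {T : measurableType d}
    (P Q : probability T R) (K : R) : Prop :=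
  forall f : T -> \bar R, measurable_fun [set: T] f -> (forall x, 0 <= f x) ->
    (\int[P]_x f x) * (\int[P]_x f x) <= K%:E * \int[Q]_x (f x * f x).

(** In Cauchy-Schwarz form, tensorization is Tonelli: the bound for the head applies to the inner
    integral [G], the inductive bound to each section of [f]. *)
Lemma chi2_le_tuple {d : measure_display} {T : measurableType d} (n : nat)
    (P Q : 'I_n -> probability T R) (K : 'I_n -> R) :
  (forall i, (0 <= K i)%R) ->
  (forall i, chi2_le (P i) (Q i) (K i)) ->
  chi2_le (tuple_prob P) (tuple_prob Q) (\prod_(i < n) K i)%R.
Proof.
elim: n P Q K => [|n IH] P Q K K0 PQ f mf f0.
  rewrite big_ord0 mul1e /= !integral_dirac ?diracT ?mul1e//.
  exact: emeasurable_funM.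
rewrite big_ord_recl EFinM.
have mff : measurable_fun [set: n.+1.-tuple T] (fun x => f x * f x).
  exact: emeasurable_funM.
have ff0 x : 0 <= f x * f x by rewrite mule_ge0.
rewrite !tuple_prob_integralS//.
set G := fun x => \int[_]_y f (tuple_cons (x, y)).
have mG : measurable_fun [set: T] G by exact: measurable_tuple_prob_section.
have G0 x : 0 <= G x by apply: integral_ge0.
apply: (le_trans (PQ ord0 G mG G0)).
rewrite -muleA lee_wpmul2l ?lee_fin//.
set K' := (\prod_(i < n) _)%R.
have K'0 : (0 <= K')%R by apply: prodr_ge0.
have mH := measurable_tuple_prob_section (fun i => Q (lift ord0 i)) mff ff0.
rewrite -ge0_integralZl//; last by move=> x _; apply: integral_ge0.
apply: ge0_le_integral => //.
- by move=> x _; rewrite mule_ge0.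
- exact: emeasurable_funM.
- exact: emeasurable_funM.
- move=> x _.
  apply: (IH (fun i => P (lift ord0 i)) (fun i => Q (lift ord0 i))
    (fun i => K (lift ord0 i)) (fun i => K0 _) (fun i => PQ _)
    (fun y => f (tuple_cons (x, y)))).
    by apply: (measurableT_comp mf); exact: measurable_tuple_cons2.
  by move=> y; exact: f0.
Qed.

(** The choice [t = K / I] turns the linear family into the quadratic bound. The linear form is the
    useful one, since it follows from a pointwise inequality by integration. *)
Lemma sqr_le_of_amgm (I J : \bar R) (K : R) : 0 <= I -> 0 <= J -> (0 < K)%R ->
  (forall t : R, (0 < t)%R -> 2%:E * I <= t%:E * J + (K / t)%:E) ->
  I * I <= K%:E * J.
Proof.
case: I => [i| |//]; case: J => [j| |//] //.
- rewrite !lee_fin => i0 j0 K0 h; have [->|in0] := eqVneq i 0%R.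
    by rewrite mul0r mulr_ge0// ltW.
  have ip : (0 < i)%R by rewrite lt_neqAle eq_sym in0.
  have Kn0 : K != 0%R by rewrite gt_eqF.
  have := h (K / i)%R (divr_gt0 K0 ip).
  rewrite -!EFinM -EFinD lee_fin (_ : K / (K / i) = i)%R; last by field; apply/andP.
  rewrite mulrAC -lerBlDr ler_pdivlMr// => h'.
  by apply: le_trans h'; rewrite le_eqVlt; apply/orP; left; apply/eqP; ring.
- by move=> _ _ K0 _; rewrite gt0_muley ?lte_fin// leey.
- by move=> _ _ K0 /(_ 1%R ltr01); rewrite gt0_muley ?lte_fin//.
- by move=> _ _ K0 _; rewrite !gt0_muley ?lte_fin.
Qed.

Let normal_pdf_gt0 (a x : R) : (0 < normal_pdf a 1 x)%R.
Proof. by rewrite normal_pdf1E mulr_gt0 ?expR_gt0// normal_peak_gt0 ?oner_neq0. Qed.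

(** The squared density at [a] divided by the density at [b] is again a multiple of a Gaussian
    density, centred at the reflection [2 * a - b]; its mass [expR ((a - b) ^+ 2)] is the exact
    chi-square moment. *)
Let normal_pdf_sqr (a b x : R) :
  (normal_pdf a 1 x ^+ 2 =
   expR ((a - b) ^+ 2) * normal_pdf b 1 x * normal_pdf (2 * a - b) 1 x)%R.
Proof.
rewrite !normal_pdf1E exprMn -expRM_natl.
transitivity (normal_peak 1 ^+ 2 * (expR ((a - b) ^+ 2) *
  expR (- ((x - b) ^+ 2 / 2)) * expR (- ((x - (2 * a - b)) ^+ 2 / 2))) : R)%R.
  by rewrite -!expRD; congr (_ * expR _)%R; field.
by ring.
Qed.

Let amgm_pdf (a b t : R) (y : \bar R) (x : R) : (0 < t)%R -> 0 <= y ->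
  2%:E * (y * (normal_pdf a 1 x)%:E) <=
  t%:E * (y * y * (normal_pdf b 1 x)%:E) +
  (expR ((a - b) ^+ 2) / t)%:E * (normal_pdf (2 * a - b) 1 x)%:E.
Proof.
move=> t0; have pa := normal_pdf_gt0 a x; have pb := normal_pdf_gt0 b x.
have pc := normal_pdf_gt0 (2 * a - b) x; have e := normal_pdf_sqr a b x.
case: y => [y| |//] y0; last first.
  by rewrite !gt0_mulye ?gt0_muley ?lte_fin// addye ?leey// -EFinM.
rewrite -!EFinM -EFinD lee_fin -subr_ge0.
move: (normal_pdf a 1 x) (normal_pdf b 1 x) (normal_pdf (2 * a - b) 1 x)
  (expR _) pa pb pc e => A B C K pa pb pc e.
rewrite (_ : _ - _ = (t * B * y - A) ^+ 2 / (t * B))%R.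
  by rewrite divr_ge0 ?sqr_ge0// mulr_ge0// ltW.
have -> : K = (A ^+ 2 / (B * C))%R.
  by rewrite e; field; apply/andP; split; rewrite gt_eqF.
by field; apply/and3P; split; rewrite gt_eqF.
Qed.

Lemma chi2_le_normal (a b : R) :
  chi2_le (normal_prob a 1) (normal_prob b 1) (expR ((a - b) ^+ 2)).
Proof.
move=> f mf f0.
have mff : measurable_fun [set: R] (fun x => f x * f x).
  exact: emeasurable_funM.
have ff0 x : 0 <= f x * f x by rewrite mule_ge0.
apply: sqr_le_of_amgm; rewrite ?expR_gt0//; try exact: integral_ge0.
move=> t t0.
rewrite (integral_normal_prob _ mf f0) (integral_normal_prob _ mff ff0).
have mp c : measurable_fun [set: measurableTypeR R]
    (fun x => (normal_pdf c 1 x)%:E).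
  by apply/measurable_EFinP; exact: measurable_normal_pdf.
have p0 c x : 0 <= (normal_pdf c 1 x)%:E by rewrite lee_fin normal_pdf_ge0.
have m1 : measurable_fun [set: measurableTypeR R]
    (fun x => f x * (normal_pdf a 1 x)%:E) by exact: emeasurable_funM.
have m2 : measurable_fun [set: measurableTypeR R]
    (fun x => f x * f x * (normal_pdf b 1 x)%:E) by exact: emeasurable_funM.
set K := expR _.
have Kt0 : 0 <= (K / t)%:E by rewrite lee_fin divr_ge0 ?expR_ge0// ltW.
(* Written as an integral of the reflected density, the constant joins the other terms and
   [amgm_pdf] applies under one integral. *)
have -> : (K / t)%:E =
    \int[lebesgue_measure]_x ((K / t)%:E * (normal_pdf (2 * a - b) 1 x)%:E).
  by rewrite ge0_integralZl// integral_normal_pdf mule1.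
rewrite -ge0_integralZl//; last by move=> x _; rewrite mule_ge0.
rewrite -ge0_integralZl//; last 2 first.
- by move=> x _; rewrite mule_ge0.
- by rewrite lee_fin ltW.
rewrite -ge0_integralD//; last 4 first.
- by move=> x _; rewrite mule_ge0 ?mule_ge0// lee_fin ltW.
- exact: measurable_funeM.
- by move=> x _; rewrite mule_ge0.
- exact: measurable_funeM.
apply: ge0_le_integral => //.
- by move=> x _; rewrite mule_ge0 ?mule_ge0.
- exact: measurable_funeM.
- by apply: emeasurable_funD; exact: measurable_funeM.
- by move=> x _; exact: amgm_pdf.
Qed.

Lemma chi2_le_gaussian (d : nat) (mu nu : d.-tuple R) :
  chi2_le (gaussian mu) (gaussian nu)
    (expR (\sum_(i < d) (tnth mu i - tnth nu i) ^+ 2)).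
Proof.
rewrite expR_sum; apply: chi2_le_tuple => i; first exact: expR_ge0.
exact: chi2_le_normal.
Qed.

Lemma chi2_le_iid {d : measure_display} {T : measurableType d} (n : nat)
    (P Q : probability T R) (c : R) :
  chi2_le P Q (expR c) -> chi2_le (iid_prob n P) (iid_prob n Q) (expR (n%:R * c)).
Proof.
move=> PQ; rewrite mulr_natl -[n in (c *+ n)%R]card_ord -sumr_const expR_sum.
by apply: chi2_le_tuple => i //; exact: expR_ge0.
Qed.

End chi_square.

(** * Change of mean of a bounded function under a chi-square bound *)

Section fluctuation.
Local Open Scope ereal_scope.
Context {d : measure_display} {T : measurableType d} {R : realType}.
Implicit Types P Q : probability T R.

Lemma prob_integrable_bounded P (f : T -> R) (M : R) :
  measurable_fun [set: T] f -> (forall x, `|f x| <= M)%R ->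
  P.-integrable [set: T] (EFin \o f).
Proof.
move=> mf fM; apply: measurable_bounded_integrable => //.
  by rewrite [X in X < _]probability_setT ltry.
exists M; split; first exact: num_real.
by move=> x Mx y _ /=; rewrite (le_trans (fM y))// ltW.
Qed.

(* Apply the chi-square bound to [g + b], with [b] such that the mean of [g + b]
   under Q is D / sqrt k: this is the shift that balances the two error terms. *)
Lemma chi2_fluctuation P Q (k D : R) (g : T -> R) (c : R) :
  chi2_le P Q (1 + k) -> (0 < k)%R -> (k <= 1)%R -> (0 < D)%R ->
  measurable_fun [set: T] g ->
  \int[Q]_x (g x)%:E = c%:E -> (forall x, `|g x - c| <= D)%R ->
  \int[P]_x (g x)%:E <= (c + D * Num.sqrt k)%:E.
Proof.
move=> PQ k0 k1 D0 mg gc gD.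
set q := Num.sqrt k.
have q0 : (0 < q)%R by rewrite sqrtr_gt0.
have qq : (q ^+ 2 = k)%R by rewrite sqr_sqrtr// ltW.
have q1 : (q <= 1)%R by rewrite -(@ler_pXn2r _ 2)// ?nnegrE ?expr1n ?qq// ltW.
pose s := (D / q)%R; pose b := (s - c)%R.
have sD : (D <= s)%R by rewrite ler_pdivlMr// ler_piMr// ltW.
have s0 : (0 < s)%R by rewrite divr_gt0.
pose f x := (g x + b)%R.
have fE x : f x = (g x - c + s)%R by rewrite /f /b; ring.
have f0 x : (0 <= f x)%R.
  by have := gD x; rewrite ler_norml fE => /andP[h1 h2]; lra.
have mf : measurable_fun [set: T] f by exact: measurable_funD.
have fs x : (f x <= s + D)%R.
  by have := gD x; rewrite ler_norml fE => /andP[h1 h2]; lra.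
have ig (P' : probability T R) : P'.-integrable [set: T] (EFin \o g).
  apply: (prob_integrable_bounded _ (M := `|c| + D)%R mg) => x.
  rewrite -(subrK c (g x)) addrC (le_trans (ler_normD _ _))// lerD2l.
  exact: gD.
have ib (P' : probability T R) : P'.-integrable [set: T] (EFin \o cst b).
  exact: (prob_integrable_bounded _ (M := `|b|)%R).
have intf (P' : probability T R) :
    \int[P']_x (f x)%:E = \int[P']_x (g x)%:E + b%:E.
  under eq_integral do rewrite /f EFinD.
  by rewrite integralD//= integral_prob_cst.
have fin : \int[P]_x (g x)%:E \is a fin_num 
  by have := integral_fune_fin_num measurableT (ig P).
have mEf : measurable_fun [set: T] (EFin \o f) by exact/measurable_EFinP.
have Ef0 x : 0 <= (EFin \o f) x by rewrite /= lee_fin.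
have := PQ _ mEf Ef0; rewrite /= intf.
(* This is [(f - s) ^ 2 <= D ^ 2] solved for [f ^ 2]: the right side is linear in [f], whose mean
   under [Q] is [s]. *)
have Qff : \int[Q]_x ((f x)%:E * (f x)%:E) <= (s ^+ 2 + D ^+ 2)%:E.
  apply: (@le_trans _ _ (\int[Q]_x ((D ^+ 2 - s ^+ 2) + 2 * s * f x)%:E)).
    apply: ge0_le_integral => //.
    - by move=> x _; rewrite -EFinM lee_fin mulr_ge0.
    - by apply/measurable_EFinP; exact: measurable_funM.
    - apply/measurable_EFinP; apply: measurable_funD => //.
      exact: measurable_funM.
    - move=> x _; rewrite -EFinM lee_fin.
      have := gD x; rewrite ler_norml fE => /andP[h1 h2]; nra.
  under eq_integral do rewrite EFinD EFinM.
  rewrite integralD//=; last 2 first.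
  + exact: (prob_integrable_bounded _ (M := `|D ^+ 2 - s ^+ 2|)%R).
  + apply: (prob_integrable_bounded _ (M := 2 * s * (s + D))%R).
      exact: measurable_funM.
    have ss : (0 <= 2 * s)%R by exact: mulr_ge0 (ltW s0).
    by move=> x; rewrite (ger0_norm (mulr_ge0 ss (f0 x))) ler_wpM2l// fs.
  rewrite integral_prob_cst ge0_integralZl//; last 2 first.
  + by move=> x _; rewrite lee_fin.
  + by rewrite lee_fin; exact: mulr_ge0 (ltW s0).
  rewrite intf gc -!EFinD lee_fin /b.
  by rewrite le_eqVlt; apply/orP; left; apply/eqP; ring.
have k1' : (0 <= 1 + k)%R by lra.
move=> /le_trans/(_ (lee_wpmul2l _ Qff)); rewrite lee_fin => /(_ k1').
rewrite -(fineK fin); set G := fine _.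
rewrite -!EFinD -!EFinM !lee_fin => h.
(* The choice of [s] makes [D ^ 2 = k * s ^ 2], so the bound is a perfect square. *)
have e : ((1 + k) * (s ^+ 2 + D ^+ 2) = (s * (1 + k)) ^+ 2)%R.
  by rewrite /s -qq; field; rewrite gt_eqF.
have {}h : (G + b <= s * (1 + k))%R.
  rewrite leNgt; apply/negP => h'.
  have s1 : (0 <= s * (1 + k))%R by exact: mulr_ge0 (ltW s0) k1'.
  have : ((s * (1 + k)) ^+ 2 < (G + b) ^+ 2)%R.
    by rewrite ltr_pXn2r// nnegrE ?ltW// (le_lt_trans s1).
  by rewrite -e expr2 ltNge h.
have e2 : (s * k = D * q)%R by rewrite /s -qq; field; rewrite gt_eqF.
rewrite /b in h; nra.
Qed.

End fluctuation.

(** * Clipped linear statistics *)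

Section clipping.
Context {R : realType}.
Implicit Types x y t : R.

(* The shift by 5 makes the clipped statistic nonnegative; 5 is large enough for
   a standard Gaussian to stay in the linear regime more than half of the time. *)
Definition clip y : R := Num.min (Num.max (y + 5) 0) 10.

Lemma clip_ge0 y : 0 <= clip y.
Proof. by rewrite /clip le_min le_max lexx orbT ler0n. Qed.

Lemma clip_le10 y : clip y <= 10.
Proof. by rewrite /clip ge_min lexx orbT. Qed.

Lemma clipE y :
  clip y = if y <= - 5 then 0 else if 5 <= y then 10 else y + 5.
Proof.
rewrite /clip; case: (leP y (- 5)) => h1.
  by rewrite max_r ?min_l//; lra.
by rewrite max_l ?minEge; [case: (leP 5 y) => h2; case: leP => h3 //; lra|lra].
Qed.

Lemma le_clip x y : x <= y -> clip x <= clip y.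
Proof.
move=> xy; rewrite !clipE.
by case: (leP x (- 5)) => ?; case: (leP 5 x) => ?;
  case: (leP y (- 5)) => ?; case: (leP 5 y) => ?; lra.
Qed.

Lemma clipD_le y t : 0 <= t -> clip (y + t) <= clip y + t.
Proof.
move=> t0; rewrite !clipE.
by case: (leP (y + t) (- 5)) => ?; case: (leP 5 (y + t)) => ?;
  case: (leP y (- 5)) => ?; case: (leP 5 y) => ?; lra.
Qed.

Lemma clipN y : clip (- y) + clip y = 10.
Proof. by rewrite !clipE; do 4?[case: leP => ?]; lra. Qed.

Lemma clip_linear y t : - 4 <= y -> y <= 4 -> 0 <= t -> t <= 1 ->
  clip (y + t) = clip y + t.
Proof. by move=> h1 h2 t0 t1; rewrite !clipE; do 4?[case: leP => ?]; lra. Qed.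

Lemma measurable_clip : measurable_fun [set: R] clip.
Proof.
apply: measurable_minr => //; apply: measurable_maxr => //.
exact: measurable_funD.
Qed.

(** Part of the shift can be lost only outside [-4, 4], where [expR y + expR (- y)] is at least
    [expR 4]; the loss is thus controlled by exponential moments. *)
Lemma clipD_ge y t : 0 <= t -> t <= 1 ->
  clip y + t <= clip (y + t) + t * expR (- 4) * (expR y + expR (- y)).
Proof.
move=> t0 t1.
have e0 : 0 <= t * expR (- 4) by rewrite mulr_ge0 ?expR_ge0.
have [h1|h1] := leP y 4; last first.
  have : 1 <= expR (- 4) * expR y by rewrite -expRD -[leLHS]expR0 ler_expR; lra.
  have : 0 <= expR (- 4) * expR (- y) by rewrite mulr_ge0 ?expR_ge0.
  have := @le_clip y (y + t); rewrite lerDl => /(_ t0).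
  rewrite mulrDr -!mulrA; nra.
have [h2|h2] := leP (- 4) y; last first.
  have : 1 <= expR (- 4) * expR (- y) by rewrite -expRD -[leLHS]expR0 ler_expR; lra.
  have : 0 <= expR (- 4) * expR y by rewrite mulr_ge0 ?expR_ge0.
  have := @le_clip y (y + t); rewrite lerDl => /(_ t0).
  rewrite mulrDr -!mulrA; nra.
by rewrite clip_linear// lerDl mulr_ge0// addr_ge0 ?expR_ge0.
Qed.

End clipping.

Section clipped_mean.
Local Open Scope ereal_scope.
Context {d : measure_display} {T : measurableType d} {R : realType}.
Variables (P : probability T R) (Y : T -> R).
Hypothesis mY : measurable_fun [set: T] Y.
Hypothesis symY : same_law P (fun x => - Y x)%R P Y.
Hypothesis mgfY : \int[P]_x (expR (Y x))%:E <= (expR (2^-1))%:E.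

Let mclipD (t : R) : measurable_fun [set: T] (fun x => (clip (Y x + t))%:E).
Proof.
apply/measurable_EFinP; apply: (measurableT_comp measurable_clip).
exact: measurable_funD.
Qed.

Let mclip : measurable_fun [set: T] (fun x => (clip (Y x))%:E).
Proof. by apply/measurable_EFinP; exact: (measurableT_comp measurable_clip). Qed.

Let clip0 y : 0 <= (clip y : R)%:E. Proof. by rewrite lee_fin clip_ge0. Qed.

Lemma clip_mean0 : \int[P]_x (clip (Y x))%:E = 5%:E.
Proof.
have h : \int[P]_x (clip (- Y x))%:E = \int[P]_x (clip (Y x))%:E.
  apply: (symY (h := fun y => (clip y)%:E)) => //.
  by apply/measurable_EFinP; exact: measurable_clip.
have mN : measurable_fun [set: T] (fun x => (clip (- Y x))%:E).
  apply/measurable_EFinP; apply: (measurableT_comp measurable_clip).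
  exact: measurableT_comp.
have : \int[P]_x (clip (- Y x))%:E + \int[P]_x (clip (Y x))%:E = 10%:E.
  rewrite -ge0_integralD//.
  under eq_integral do rewrite -EFinD clipN.
  by rewrite integral_prob_cst.
rewrite h; have : 0 <= \int[P]_x (clip (Y x))%:E by apply: integral_ge0.
case: (\int[P]_x _) => [r| |] //= _.
by rewrite -EFinD => -[e]; congr EFin; lra.
Qed.

Lemma clip_mean_le (t : R) : (0 <= t)%R ->
  \int[P]_x (clip (Y x + t))%:E <= (5 + t)%:E.
Proof.
move=> t0; rewrite EFinD -clip_mean0 -[X in _ + X](integral_prob_cst P).
rewrite -ge0_integralD//.
apply: ge0_le_integral => //.
  by apply: emeasurable_funD.
by move=> x _; rewrite -EFinD lee_fin clipD_le.
Qed.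

Lemma clip_mean_ge (t : R) : (0 <= t)%R -> (t <= 1)%R ->
  (5 + t / 2)%:E <= \int[P]_x (clip (Y x + t))%:E.
Proof.
move=> t0 t1.
have me : measurable_fun [set: T] (fun x => (expR (Y x))%:E).
  by apply/measurable_EFinP; exact: measurableT_comp.
have meN : measurable_fun [set: T] (fun x => (expR (- Y x))%:E).
  apply/measurable_EFinP; apply: measurableT_comp => //.
  exact: measurableT_comp.
have e0 (y : R) : 0 <= (expR y)%:E by rewrite lee_fin expR_ge0.
have hN : \int[P]_x (expR (- Y x))%:E <= (expR (2^-1))%:E.
  rewrite (symY (h := fun y => (expR y)%:E))//.
  by apply/measurable_EFinP; exact: measurable_expR.
pose c := (t * expR (- 4))%R.
have c0 : (0 <= c)%R by rewrite mulr_ge0 ?expR_ge0.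
have H : 5%:E + t%:E <= \int[P]_x (clip (Y x + t))%:E +
    c%:E * (\int[P]_x (expR (Y x))%:E + \int[P]_x (expR (- Y x))%:E).
  rewrite -clip_mean0 -[X in _ + X <= _](integral_prob_cst P).
  rewrite -ge0_integralD//.
  rewrite -ge0_integralD// -ge0_integralZl//; last 2 first.
  - exact: emeasurable_funD.
  - by move=> x _; rewrite adde_ge0.
  rewrite -ge0_integralD//; last 2 first.
  - by move=> x _; rewrite mule_ge0 ?lee_fin// addr_ge0 ?expR_ge0.
  - by apply: measurable_funeM; exact: emeasurable_funD.
  apply: ge0_le_integral => //.
  - by move=> x _; rewrite -EFinD lee_fin addr_ge0 ?clip_ge0.
  - exact: emeasurable_funD.
  - apply: emeasurable_funD => //; apply: measurable_funeM.
    exact: emeasurable_funD.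
  - by move=> x _; rewrite -!EFinD lee_fin clipD_ge.
have {}H : 5%:E + t%:E <= \int[P]_x (clip (Y x + t))%:E +
    c%:E * ((expR (2^-1))%:E + (expR (2^-1))%:E).
  by apply: (le_trans H); rewrite leeD2l// lee_wpmul2l ?lee_fin// leeD.
(* The loss is at most [2 * expR (- 7 / 2)] times [t], and [expR (7 / 2) >= 1 + 7 / 2] makes this at
   most half of the shift. *)
have num : (c * (expR 2^-1 + expR 2^-1) <= t / 2)%R.
  rewrite /c -mulrA ler_wpM2l// mulrDr -expRD.
  have e1 := @expR_ge1Dx R (7 / 2).
  have -> : (- 4 + 2^-1 = - (7 / 2) :> R)%R by lra.
  rewrite expRN; have ep : (0 < expR (7 / 2) :> R)%R by exact: expR_gt0.
  have : ((expR (7 / 2))^-1 <= (4^-1 : R))%R.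
    by rewrite lef_pV2 ?posrE//; lra.
  by lra.
move: H; have : 0 <= \int[P]_x (clip (Y x + t))%:E by apply: integral_ge0.
case: (\int[P]_x _) => [r| |//] _; last by move=> _; exact: leey.
by rewrite -!EFinD !lee_fin => H; lra.
Qed.

End clipped_mean.

(** * Linear statistics of a Gaussian sample *)

Section linear_statistics.
Context {R : realType}.
Variables (d m : nat).
Implicit Types (mu a : d.-tuple R) (u : 'I_d -> R) (w : R).

(** The algorithm takes [w = gain / m], and the separation of two Gaussians takes [w = 1] with a
    single example. *)
Definition user_stat w u a (x : m.-tuple (d.-tuple (measurableTypeR R))) : R :=
  \sum_(k < m) \sum_(c < d) w * u c * (tnth (tnth x k) c - tnth a c).

Definition origin : d.-tuple R := [tuple 0 | _ < d].

Lemma tnth_origin c : tnth origin c = 0.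
Proof. by rewrite tnth_mktuple. Qed.

Let mcoord w u a (c : 'I_d) :
  measurable_fun [set: measurableTypeR R] (fun x : R => w * u c * (x - tnth a c)).
Proof. by apply: measurable_funM => //; exact: measurable_funB. Qed.

Let mrow w u a : measurable_fun [set: d.-tuple (measurableTypeR R)]
  (fun x => \sum_(c < d) w * u c * (tnth x c - tnth a c) : R).
Proof. exact: (measurable_tuple_sum (mcoord w u a)). Qed.

Lemma measurable_user_stat w u a : measurable_fun
  [set: m.-tuple (d.-tuple (measurableTypeR R))] (user_stat w u a).
Proof. exact: (measurable_tuple_sum (fun=> mrow w u a)). Qed.

Let normal_law_shift (nu k b : R) (h : R -> \bar R) :
  measurable_fun [set: R] h -> (forall z, 0 <= h z)%E ->
  (\int[normal_prob nu 1]_x h (k * (x - b))%R =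
   \int[normal_prob 0 1]_z h (k * (z - 0) + k * (nu - b))%R)%E.
Proof.
move=> mh h0.
have mf : measurable_fun [set: R] (fun x => h (k * (x - b))).
  apply: (measurableT_comp mh); apply: measurable_funM => //.
  exact: measurable_funB.
have := integral_normal_shift 0 nu mf (fun=> h0 _).
rewrite add0r => ->; apply: eq_integral => z _.
have e : forall x : R, k * (x + nu - b) = k * (x - 0) + k * (nu - b).
  by move=> x; ring.
by rewrite e.
Qed.

Let normal_lawN (k : R) (h : R -> \bar R) :
  measurable_fun [set: R] h -> (forall z, 0 <= h z)%E ->
  (\int[normal_prob (0 : R) 1]_x h (- (k * (x - 0)))%R =
   \int[normal_prob 0 1]_z h (k * (z - 0))%R)%E.
Proof.
move=> mh h0.
have mf : measurable_fun [set: R] (fun x => h (k * (x - 0))).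
  apply: (measurableT_comp mh); apply: measurable_funM => //.
  exact: measurable_funB.
have <- := integral_normalN mf (fun=> h0 _).
apply: eq_integral => z _.
have e : forall x : R, - (k * (x - 0)) = k * (- x - 0) by move=> x; ring.
by rewrite e.
Qed.

(** Each coordinate is a translate of a centred one, so the mean and the recentring point enter only
    through a deterministic shift of one fixed symmetric variable. *)
Lemma same_law_user_stat w u a mu :
  same_law (iid_prob m (gaussian mu)) (user_stat w u a)
    (iid_prob m (gaussian origin))
    (fun z => user_stat w u origin z +
       m%:R * w * \sum_(c < d) u c * (tnth mu c - tnth a c)).
Proof.
pose t c := w * u c * (tnth mu c - tnth a c).
have mY c : measurable_fun [set: measurableTypeR R]
    (fun z : R => w * u c * (z - tnth origin c) + t c).
  by apply: measurable_funD => //; exact: mcoord.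
have h1 : same_law (gaussian mu)
    (fun x => \sum_(c < d) w * u c * (tnth x c - tnth a c))
    (gaussian origin)
    (fun z => \sum_(c < d) (w * u c * (tnth z c - tnth origin c) + t c)).
  apply: (@same_law_sum R _ _ (measurableTypeR R) (measurableTypeR R) d
    (fun c => normal_prob (tnth mu c) 1) (fun c x => w * u c * (x - tnth a c))
    (fun c => normal_prob (tnth origin c) 1)
    (fun c z => w * u c * (z - tnth origin c) + t c)
    (mcoord w u a) mY) => c h mh h0.
  by rewrite tnth_origin; exact: normal_law_shift.
have h2 := @same_law_sum R _ _ _ _ m (fun=> gaussian mu) (fun _ x =>
    \sum_(c < d) w * u c * (tnth x c - tnth a c)) (fun=> gaussian origin)
    (fun _ z => \sum_(c < d) (w * u c * (tnth z c - tnth origin c) + t c))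
    (fun=> mrow w u a) (fun=> measurable_tuple_sum mY) (fun=> h1).
rewrite (_ : (fun z => _ + _) = (fun y : m.-tuple (d.-tuple (measurableTypeR R)) =>
  \sum_(i < m) \sum_(c < d)
    (w * u c * (tnth (tnth y i) c - tnth origin c) + t c)))//.
apply/funext => z; under [RHS]eq_bigr do rewrite big_split.
rewrite big_split; congr (_ + _) => /=.
rewrite sumr_const card_ord -[RHS]mulr_natl -mulrA mulr_sumr; congr (_ * _).
by apply: eq_bigr => c _; rewrite /t mulrA.
Qed.

Lemma same_law_user_statN w u :
  same_law (iid_prob m (gaussian origin)) (fun z => - user_stat w u origin z)
    (iid_prob m (gaussian origin)) (user_stat w u origin).
Proof.
have mN c : measurable_fun [set: measurableTypeR R]
    (fun x : R => - (w * u c * (x - tnth origin c))).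
  by apply: (@measurableT_comp _ _ _ _ _ _ (-%R : R -> R)) => //; exact: mcoord.
have h1 : same_law (gaussian origin)
    (fun x => \sum_(c < d) - (w * u c * (tnth x c - tnth origin c)))
    (gaussian origin)
    (fun z => \sum_(c < d) w * u c * (tnth z c - tnth origin c)).
  apply: (@same_law_sum R _ _ (measurableTypeR R) (measurableTypeR R) d
    (fun c => normal_prob (tnth origin c) 1)
    (fun c x => - (w * u c * (x - tnth origin c)))
    (fun c => normal_prob (tnth origin c) 1)
    (fun c z => w * u c * (z - tnth origin c))
    mN (mcoord w u origin)) => c h mh h0.
  by rewrite tnth_origin; exact: normal_lawN.
have h2 := @same_law_sum R _ _ _ _ m (fun=> gaussian origin) (fun _ x =>
    \sum_(c < d) - (w * u c * (tnth x c - tnth origin c))) (fun=> gaussian origin)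
    (fun _ z => \sum_(c < d) w * u c * (tnth z c - tnth origin c))
    (fun=> measurable_tuple_sum mN) (fun=> mrow w u origin) (fun=> h1).
rewrite (_ : (fun z => - _) = (fun y : m.-tuple (d.-tuple (measurableTypeR R)) =>
  \sum_(i < m) \sum_(c < d) - (w * u c * (tnth (tnth y i) c - tnth origin c))))//.
apply/funext => z; rewrite /user_stat -sumrN.
by apply: eq_bigr => k _; rewrite sumrN.
Qed.

Lemma user_stat_mgf w u :
  (\int[iid_prob m (gaussian origin)]_x (expR (user_stat w u origin x))%:E =
   (expR (m%:R * (w ^+ 2 * \sum_(c < d) u c ^+ 2) / 2))%:E)%E.
Proof.
have me c : measurable_fun [set: measurableTypeR R]
    (fun x : R => expR (w * u c * (x - tnth origin c))).
  by apply: measurableT_comp => //; exact: mcoord.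
have h1 : (\int[gaussian origin]_x
    (expR (\sum_(c < d) w * u c * (tnth x c - tnth origin c)))%:E =
    (expR (w ^+ 2 * \sum_(c < d) u c ^+ 2 / 2))%:E)%E.
  under eq_integral do rewrite expR_sum.
  rewrite (integral_tuple_prod _ me) => [|c x]; last exact: expR_ge0.
  transitivity (\prod_(c < d) (expR ((w * u c) ^+ 2 / 2))%:E)%E.
    apply: eq_bigr => c _; rewrite tnth_origin.
    by under eq_integral do rewrite subr0; rewrite integral_normal_expR.
  rewrite prodEFin -expR_sum mulr_sumr; congr (expR _)%:E.
  by apply: eq_bigr => c _; rewrite exprMn mulrA.
under eq_integral do rewrite expR_sum.
rewrite (integral_tuple_prod (fun=> gaussian origin) (g := fun _ x =>
  expR (\sum_(c < d) w * u c * (tnth x c - tnth origin c)))); last 2 first.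
- by move=> _; apply: measurableT_comp => //; exact: mrow.
- by move=> _ x; exact: expR_ge0.
under eq_bigr do rewrite h1.
rewrite prodEFin -expR_sum sumr_const card_ord -mulr_suml.
by rewrite -[X in expR X](@mulr_natl R) !mulrA.
Qed.

(** The first hypothesis says that the statistic has variance at most 1, which bounds its
    exponential moment. A shift beyond [t] does no harm because [clip] is monotone. *)
Lemma user_stat_clip_ge w u a mu (t : R) :
  m%:R * (w ^+ 2 * \sum_(c < d) u c ^+ 2) <= 1 -> 0 <= t -> t <= 1 ->
  t <= m%:R * w * \sum_(c < d) u c * (tnth mu c - tnth a c) ->
  ((5 + t / 2)%:E <=
   \int[iid_prob m (gaussian mu)]_x (clip (user_stat w u a x))%:E)%E.
Proof.
move=> h t0 t1 tle.
have mc : measurable_fun [set: R] (fun y : R => (clip y)%:E).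
  by apply/measurable_EFinP; exact: measurable_clip.
have c0 (y : R) : (0 <= (clip y)%:E)%E by rewrite lee_fin clip_ge0.
rewrite (same_law_user_stat w u a mu mc c0).
have mgf : (\int[iid_prob m (gaussian origin)]_x
    (expR (user_stat w u origin x))%:E <= (expR 2^-1)%:E)%E.
  by rewrite user_stat_mgf lee_fin ler_expR ler_pdivrMr// mulVf.
have := clip_mean_ge (measurable_user_stat w u origin)
  (same_law_user_statN w u) mgf t0 t1.
move=> /le_trans; apply; apply: ge0_le_integral => //.
- apply: (measurableT_comp mc); apply: measurable_funD => //.
  exact: measurable_user_stat.
- apply: (measurableT_comp mc); apply: measurable_funD => //.
  exact: measurable_user_stat.
- by move=> x _; rewrite lee_fin le_clip// lerD2l.
Qed.

Lemma user_stat_clip_le w u a mu (t : R) :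
  m%:R * (w ^+ 2 * \sum_(c < d) u c ^+ 2) <= 1 -> 0 <= t ->
  m%:R * w * \sum_(c < d) u c * (tnth mu c - tnth a c) <= t ->
  (\int[iid_prob m (gaussian mu)]_x (clip (user_stat w u a x))%:E <=
   (5 + t)%:E)%E.
Proof.
move=> h t0 tle.
have mc : measurable_fun [set: R] (fun y : R => (clip y)%:E).
  by apply/measurable_EFinP; exact: measurable_clip.
have c0 (y : R) : (0 <= (clip y)%:E)%E by rewrite lee_fin clip_ge0.
rewrite (same_law_user_stat w u a mu mc c0).
have := clip_mean_le (measurable_user_stat w u origin)
  (same_law_user_statN w u) t0.
apply: le_trans; apply: ge0_le_integral => //.
- apply: (measurableT_comp mc); apply: measurable_funD => //.
  exact: measurable_user_stat.
- apply: (measurableT_comp mc); apply: measurable_funD => //.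
  exact: measurable_user_stat.
- by move=> x _; rewrite lee_fin le_clip// lerD2l.
Qed.

End linear_statistics.

(** * Total variation distance *)

Section total_variation.
Context {R : realType}.

Lemma expR_le_quadratic (u : R) : u <= 2^-1 -> expR u <= 1 + u + 2 * u ^+ 2.
Proof.
move=> hu; have h := @expR_ge1Dx R (- u).
have u1 : 0 < 1 - u by lra.
have -> : expR u = (expR (- u))^-1 by rewrite expRN invrK.
apply: (@le_trans _ _ (1 - u)^-1).
  by rewrite lef_pV2 ?posrE ?expR_gt0.
rewrite -[leLHS]mul1r ler_pdivrMr//.
have -> : (1 + u + 2 * u ^+ 2) * (1 - u) = 1 + u ^+ 2 * (1 - 2 * u) by ring.
by rewrite lerDl mulr_ge0 ?sqr_ge0//; lra.
Qed.

Lemma chi2_leW {d : measure_display} {T : measurableType d}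
    (P Q : probability T R) (K L : R) : K <= L -> chi2_le P Q K -> chi2_le P Q L.
Proof.
move=> KL h f mf f0; apply: (le_trans (h f mf f0)).
rewrite lee_wpmul2r ?lee_fin//; apply: integral_ge0 => x _.
by rewrite mule_ge0.
Qed.

(** The fluctuation bound for an indicator, which stays within 1 of its mean, with [sqrt k = a]. *)
Lemma chi2_le_prob {d : measure_display} {T : measurableType d}
    (P Q : probability T R) (a : R) (A : set T) : 0 < a -> a <= 1 ->
  chi2_le P Q (1 + a ^+ 2) -> measurable A -> (P A <= Q A + a%:E)%E.
Proof.
move=> a0 a1 PQ mA.
have QA : Q A \is a fin_num by exact: fin_num_measure.
have qA0 : 0 <= fine (Q A) by rewrite fine_ge0.
have qA1 : fine (Q A) <= 1.
  by rewrite -lee_fin fineK// probability_le1.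
have := @chi2_fluctuation _ T R P Q (a ^+ 2) 1 (\1_A) (fine (Q A)) PQ.
rewrite !integral_indic// !setIT fineK// mul1r sqrtr_sqr (ger0_norm (ltW a0)).
rewrite EFinD fineK//; apply => //.
- by rewrite exprn_gt0.
- by rewrite exprn_ile1// ltW.
- move=> x; rewrite indicE ler_norml; case: (x \in A) => /=; lra.
Qed.

Lemma abse_sub_le (x y : \bar R) (a : R) : x \is a fin_num -> y \is a fin_num ->
  (x <= y + a%:E)%E -> (y <= x + a%:E)%E -> (`|x - y| <= a%:E)%E.
Proof.
case: x => // x; case: y => // y _ _; rewrite -EFinB -!EFinD !lee_fin ler_norml.
by move=> h1 h2; apply/andP; split; lra.
Qed.

Lemma tv_dist_le {d : measure_display} {T : measurableType d}
    (P Q : probability T R) (a : R) :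
  (forall A, measurable A -> P A <= Q A + a%:E)%E ->
  (forall A, measurable A -> Q A <= P A + a%:E)%E ->
  (tv_dist P Q <= a%:E)%E.
Proof.
move=> h1 h2; apply: ge_ereal_sup => _ [A mA <-].
have f1 : P A \is a fin_num by exact: fin_num_measure.
have f2 : Q A \is a fin_num by exact: fin_num_measure.
exact: abse_sub_le f1 f2 (h1 A mA) (h2 A mA).
Qed.

Lemma tv_gaussian_le (d : nat) (mu nu : d.-tuple R) (a : R) : 0 < a -> a <= 1 ->
  \sum_(i < d) (tnth mu i - tnth nu i) ^+ 2 <= a ^+ 2 / 4 ->
  (tv_dist (gaussian mu) (gaussian nu) <= a%:E)%E.
Proof.
move=> a0 a1 h.
have key (m1 m2 : d.-tuple R) :
    \sum_(i < d) (tnth m1 i - tnth m2 i) ^+ 2 <= a ^+ 2 / 4 ->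
    chi2_le (gaussian m1) (gaussian m2) (1 + a ^+ 2).
  move=> h'; apply: chi2_leW (chi2_le_gaussian m1 m2).
  set S := \sum_(i < d) _ in h' *.
  have S0 : 0 <= S by apply: sumr_ge0 => i _; exact: sqr_ge0.
  have a2 : a ^+ 2 <= 1 by rewrite exprn_ile1// ltW.
  have /expR_le_quadratic : S <= 2^-1 by lra.
  by move=> /le_trans; apply; nra.
have h' : \sum_(i < d) (tnth nu i - tnth mu i) ^+ 2 <= a ^+ 2 / 4.
  by apply: le_trans h; apply: ler_sum => i _; rewrite -sqrrN opprB.
move: (key _ _ h) (key _ _ h'); move: (gaussian mu) (gaussian nu) => P Q k1 k2.
by apply: tv_dist_le => A mA; exact: chi2_le_prob.
Qed.

(** Layer cake: the integral of [g] is that of the probability of [g > r] over [r]. Levels above 1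
    contribute nothing, so the error [a] is paid only on [0, 1]. *)
Lemma integral_le_of_prob_le {d : measure_display} {T : measurableType d}
    (P Q : probability T R) (a : R) (g : T -> R) :
  0 <= a -> (forall A, measurable A -> (P A <= Q A + a%:E)%E) ->
  measurable_fun [set: T] g -> (forall x, 0 <= g x <= 1) ->
  (\int[P]_x (g x)%:E <= \int[Q]_x (g x)%:E + a%:E)%E.
Proof.
move=> a0 PQ mg g01.
pose gm := isMeasurableFun.Build _ _ T R g mg.
pose X : {mfun T >-> R} := HB.pack g gm.
have g0 x : 0 <= X x by have /andP[] := g01 x.
have EP : (\int[P]_x (g x)%:E =
    \int[lebesgue_measure]_(r in `[0%R, +oo[) P (g @^-1` `]r, +oo[))%E.
  have := ge0_expectation_ccdf (P := P) (X := X) g0.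
  by rewrite expectation_def.
have EQ : (\int[Q]_x (g x)%:E =
    \int[lebesgue_measure]_(r in `[0%R, +oo[) Q (g @^-1` `]r, +oo[))%E.
  have := ge0_expectation_ccdf (P := Q) (X := X) g0.
  by rewrite expectation_def.
have mcP : measurable_fun [set: R] (fun r => P (g @^-1` `]r, +oo[)).
  exact: (@ccdf_measurable _ _ _ P X).
have mcQ : measurable_fun [set: R] (fun r => Q (g @^-1` `]r, +oo[)).
  exact: (@ccdf_measurable _ _ _ Q X).
have -> : a%:E = (\int[lebesgue_measure]_(r in `[0%R, +oo[)
    (a%:E * (\1_`[0%R, 1%R] r)%:E))%E.
  rewrite ge0_integralZl//; last first.
    by apply/measurable_funTS/measurable_EFinP; exact: measurable_indic.
  rewrite integral_indic// setIidl; last first.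
    by move=> r /=; rewrite !in_itv/= andbT => /andP[].
  by rewrite [X in (_ * X)%E](@lebesgue_measure_itv R `[0%R, 1%R])/= lte01 oppr0 adde0 mule1.
rewrite EP EQ -ge0_integralD//; last 3 first.
- exact: measurable_funTS.
- by move=> r _; rewrite mule_ge0// lee_fin indicE.
- apply/measurable_funTS/measurable_funeM/measurable_EFinP.
  exact: measurable_indic.
apply: ge0_le_integral => //.
- exact: measurable_funTS.
- apply: emeasurable_funD; first exact: measurable_funTS.
  apply/measurable_funTS/measurable_funeM/measurable_EFinP.
  exact: measurable_indic.
- move=> r /=; rewrite in_itv/= andbT => r0.
  have mA : measurable (g @^-1` `]r, +oo[).
    by rewrite -[X in measurable X]setTI; exact: (mg measurableT).
  rewrite indicE; have [r1|r1] := leP r 1.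
    by rewrite mem_set/= ?in_itv/= ?r0// mule1; exact: PQ.
  rewrite (_ : g @^-1` _ = set0) ?measure0 ?adde_ge0 ?mule_ge0//.
  apply/seteqP; split=> // x /=; rewrite in_itv/= andbT => rg.
  by have /andP[_] := g01 x; lra.
Qed.

Lemma tv_dist_le_prob {d : measure_display} {T : measurableType d}
    (P Q : probability T R) (a : R) (A : set T) : measurable A ->
  (tv_dist P Q <= a%:E)%E -> (P A <= Q A + a%:E)%E /\ (Q A <= P A + a%:E)%E.
Proof.
move=> mA h.
have : (`|P A - Q A| <= a%:E)%E.
  by apply: le_trans h; apply: ereal_sup_ubound; exists A.
have f1 : P A \is a fin_num by exact: fin_num_measure.
have f2 : Q A \is a fin_num by exact: fin_num_measure.
rewrite -(fineK f1) -(fineK f2) -EFinB -!EFinD !lee_fin ler_norml.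
by move=> /andP[h1 h2]; split; lra.
Qed.

Lemma integral_iid1 {d : measure_display} {T : measurableType d}
    (P : probability T R) (f : 1.-tuple T -> \bar R) :
  measurable_fun [set: 1.-tuple T] f -> (forall x, 0 <= f x)%E ->
  (\int[iid_prob 1 P]_x f x = \int[P]_x f [tuple x])%E.
Proof.
move=> mf f0; rewrite /iid_prob tuple_prob_integralS//.
apply: eq_integral => x _ /=; rewrite integral_dirac//= ?diracT ?mul1e.
  by congr f; apply: val_inj.
by apply: (measurableT_comp mf); exact: measurable_tuple_cons2.
Qed.

(** Origin of the constant 40: on the scale of a statistic with values in [0, 10], two steps of [a]
    account for [20 * a], while the means differ by [rho / 2]. *)
Let mean_gap_le (x y q : \bar R) (a rho : R) :
  x \is a fin_num -> y \is a fin_num -> q \is a fin_num ->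
  ((5 + rho / 2)%:E <= 10%:E * x)%E -> (10%:E * y <= (5 + 0)%:E)%E ->
  (x <= q + a%:E)%E -> (q <= y + a%:E)%E -> rho <= 40 * a.
Proof.
case: x => // x; case: y => // y; case: q => // q _ _ _.
by rewrite -!EFinM -!EFinD !lee_fin => *; lra.
Qed.

(* Test both hypotheses against the clipped statistic in the direction of
   [mu - nu], whose mean shifts linearly with the distance. *)
Lemma tv_gaussian_separation (d : nat) (mu nu : d.-tuple R) (a : R)
    (Q : probability (d.-tuple (measurableTypeR R)) R) :
  0 <= a ->
  \sum_(c < d) (tnth mu c - tnth nu c) ^+ 2 <= 1 ->
  (tv_dist Q (gaussian mu) <= a%:E)%E -> (tv_dist Q (gaussian nu) <= a%:E)%E ->
  \sum_(c < d) (tnth mu c - tnth nu c) ^+ 2 <= (40 * a) ^+ 2.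
Proof.
move=> a0 S1 hmu hnu; set S := \sum_(c < d) _ in S1 *.
have S0 : 0 <= S by apply: sumr_ge0 => c _; exact: sqr_ge0.
have [->|Sn0] := eqVneq S 0; first exact: sqr_ge0.
pose rho := Num.sqrt S.
have rho2 : rho ^+ 2 = S by rewrite sqr_sqrtr.
have rho0 : 0 < rho by rewrite sqrtr_gt0 lt_neqAle eq_sym Sn0.
have rho1 : rho <= 1 by rewrite -sqrtr1 ler_sqrt.
pose u c := (tnth mu c - tnth nu c) / rho.
have uu : \sum_(c < d) u c ^+ 2 = 1.
  transitivity (\sum_(c < d) (tnth mu c - tnth nu c) ^+ 2 / S).
    by apply: eq_bigr => c _; rewrite exprMn exprVn rho2.
  by rewrite -mulr_suml divff.
have hu : (1%:R : R) * (1 ^+ 2 * \sum_(c < d) u c ^+ 2) <= 1.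
  by rewrite uu expr1n !mul1r.
have du : \sum_(c < d) u c * (tnth mu c - tnth nu c) = rho.
  transitivity (\sum_(c < d) (tnth mu c - tnth nu c) ^+ 2 / rho).
    by apply: eq_bigr => c _; rewrite /u expr2 mulrAC.
  by rewrite -mulr_suml -/S -rho2 expr2 mulfK// gt_eqF.
pose f (x : 1.-tuple (d.-tuple (measurableTypeR R))) :=
  clip (user_stat 1 u nu x).
have mf : measurable_fun [set: 1.-tuple (d.-tuple (measurableTypeR R))] f.
  apply: (measurableT_comp measurable_clip); exact: measurable_user_stat.
have mEf : measurable_fun [set: 1.-tuple (d.-tuple (measurableTypeR R))]
  (fun x => (f x)%:E) by exact/measurable_EFinP.
have Ef0 x : (0 <= (f x)%:E)%E by rewrite lee_fin clip_ge0.
have hi := @user_stat_clip_ge R d 1 1 u nu mu rho hu (ltW rho0) rho1.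
have lo := @user_stat_clip_le R d 1 1 u nu nu 0 hu (lexx 0).
rewrite du !mul1r lexx in hi; have {}hi := hi isT.
rewrite big1 ?mulr0 ?lexx in lo; last by move=> c _; rewrite subrr mulr0.
have {}lo := lo isT.
rewrite integral_iid1// in hi; rewrite integral_iid1// in lo.
pose g (x : d.-tuple (measurableTypeR R)) := f [tuple x] / 10.
have mtup : measurable_fun [set: d.-tuple (measurableTypeR R)]
   (fun x => [tuple x] : 1.-tuple (d.-tuple (measurableTypeR R))).
  by apply/measurable_fun_tnthP => i; rewrite ord1; exact: measurable_id.
have mfg : measurable_fun [set: d.-tuple (measurableTypeR R)] (fun x => f [tuple x]).
  exact: (measurableT_comp mf mtup).
have mg : measurable_fun [set: d.-tuple (measurableTypeR R)] g.
  exact: measurable_funM.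
have g01 x : 0 <= g x <= 1.
  rewrite /g divr_ge0 ?clip_ge0//= ler_pdivrMr// mul1r; exact: clip_le10.
have int10 (P : probability (d.-tuple (measurableTypeR R)) R) :
    (\int[P]_x (f [tuple x])%:E = 10%:E * \int[P]_x (g x)%:E)%E.
  rewrite -ge0_integralZl//; last 2 first.
  - exact/measurable_EFinP.
  - by move=> x _; rewrite lee_fin; have /andP[] := g01 x.
  by apply: eq_integral => x _; rewrite -EFinM /g mulrC divfK.
have h1 : (\int[gaussian mu]_x (g x)%:E <= \int[Q]_x (g x)%:E + a%:E)%E.
  by apply: integral_le_of_prob_le => // A mA; case: (tv_dist_le_prob mA hmu).
have h2 : (\int[Q]_x (g x)%:E <= \int[gaussian nu]_x (g x)%:E + a%:E)%E.
  by apply: integral_le_of_prob_le => // A mA; case: (tv_dist_le_prob mA hnu).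
rewrite int10 in hi; rewrite int10 in lo.
have ig (P : probability (d.-tuple (measurableTypeR R)) R) :
    (\int[P]_x (g x)%:E)%E \is a fin_num.
  have := @prob_integrable_bounded _ _ R P g 1 mg.
  have g1 x : `|g x| <= 1 by have /andP[? ?] := g01 x; rewrite ger0_norm.
  by move=> /(_ g1) ip; exact: (integral_fune_fin_num measurableT ip).
have {hi lo h1 h2} h := mean_gap_le (ig _) (ig _) (ig _) hi lo h1 h2.
by rewrite -rho2 ler_pXn2r// nnegrE ?ltW// (lt_le_trans rho0).
Qed.

End total_variation.

(** * Measurability of a single distribution *)

Section probability_singletons.
Context {R : realType} {d : nat}.
Local Notation V := (d.-tuple (measurableTypeR R)).

(* [None] stands for an unbounded side: the half-line generators are then boxes,
   and boxes form a countable intersection-stable generator. *)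
Definition rat_box (q : {ffun 'I_d -> option rat}) : set V :=
  [set x | forall i, if q i is Some r then (ratr r : R) < tnth x i else true].

Lemma measurable_rat_box q : measurable (rat_box q).
Proof.
rewrite (_ : rat_box q = \bigcap_(i in [set: 'I_d])
    ((fun x : V => tnth x i) @^-1`
      (if q i is Some r then `](ratr r : R), +oo[%classic else setT))).
  apply: fin_bigcap_measurable => // i _.
  rewrite -[X in measurable X]setTI.
  by apply: measurable_tnth => //; case: (q i).
apply/seteqP; split => x h i; [move=> _|]; have := h i; rewrite /=.
  by case: (q i) => [r|//]; rewrite /= in_itv/= andbT.
by case: (q i) => [r|//] /(_ Logic.I); rewrite /= in_itv/= andbT.
Qed.

Let box_max (q q' : option rat) : option rat :=
  match q, q' with
  | Some r, Some r' => Some (Num.max r r')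
  | Some r, None => Some r
  | None, q' => q'
  end.

Let rat_boxI q q' :
  rat_box q `&` rat_box q' = rat_box [ffun i => box_max (q i) (q' i)].
Proof.
apply/seteqP; split => x /=.
  move=> [h h'] i; have := h i; have := h' i; rewrite ffunE.
  case: (q i) => [r|]; case: (q' i) => [r'|]//=.
  by rewrite /Num.max; case: ifP.
move=> h; split=> i; have := h i; rewrite ffunE;
  case: (q i) => [r|]; case: (q' i) => [r'|]//=.
- by apply: le_lt_trans; rewrite ler_rat le_max lexx.
- by apply: le_lt_trans; rewrite ler_rat le_max lexx orbT.
Qed.

Let G : set (set V) := range rat_box.

Let measurable_tuple_rat_box : @measurable _ V `<=` <<s G >>.
Proof.
apply: smallest_sub; first exact: smallest_sigma_algebra.
rewrite -bigcup_seq => A [i _ [B mB <-]]; rewrite setTI.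
move: B mB.
have : (@ocitv R).-sigma.-measurable `<=`
    [set B | <<s G >> ((fun x : V => tnth x i) @^-1` B)].
  rewrite RGenOInfty.measurableE; apply: smallest_sub.
    split => //=.
    - by rewrite preimage_set0; exact: sigma_algebra0.
    - move=> B mB; rewrite setTD.
      rewrite -preimage_setC -setTD; exact: sigma_algebraCD.
    - move=> F mF; rewrite preimage_bigcup.
      exact: sigma_algebra_bigcup.
  move=> _ [t ->] /=.
  (* By density of the rationals, the half-line is a countable union of boxes that constrain
     coordinate [i] alone. *)
  have -> : (fun x : V => tnth x i) @^-1` `]t, +oo[ =
      \bigcup_n (if unpickle n is Some r then
        if t < ratr r then rat_box [ffun j => if j == i then Some r else None]
        else set0 else set0).
    apply/seteqP; split => x /=.
      rewrite in_itv/= andbT => tx.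
      have [r] := rat_in_itvoo tx; rewrite in_itv/= => /andP[tr rx].
      exists (pickle r); first exact: Logic.I.
      rewrite pickleK tr => j; rewrite ffunE.
      by case: eqP => // ->.
    move=> [n _]; case: unpickle => [r|//]; case: ifP => // tr /(_ i).
    by rewrite ffunE eqxx in_itv/= andbT; exact: lt_trans.
  apply: sigma_algebra_bigcup => n; case: unpickle => [r|].
    case: ifP => _; last exact: sigma_algebra0.
    by apply: sub_sigma_algebra; exists [ffun j => if j == i then Some r else None].
  exact: sigma_algebra0.
by move=> h B mB; exact: h.
Qed.

(** Equality with [Q0] on all measurable sets follows from equality on the countably many rational
    boxes, a generating pi-system, and each of these equalities is a measurable condition. Finite
    sets of correct outputs thereby become measurable events. *)
Lemma measurable_eq_prob (Q0 : probability V R) :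
  measurable [set Q : pprobability V R |
    forall A, measurable A -> (Q : probability V R) A = Q0 A].
Proof.
rewrite (_ : mkset _ = \bigcap_(n in [set: nat])
    [set Q : pprobability V R | if unpickle n is Some q then
       (Q : probability V R) (rat_box q) = Q0 (rat_box q) else True]).
  apply: bigcapT_measurable => n; case: unpickle => [q|]; last first.
    exact: measurableT.
  have me := @measurable_kernel _ _ _ _ R
    (kprobability (@measurable_id _ (pprobability V R) setT))
    (rat_box q) (measurable_rat_box q).
  have := me measurableT [set Q0 (rat_box q)] (emeasurable_set1 _).
  by rewrite setTI.
apply/seteqP; split => Q /=.
  by move=> h n _; case: unpickle => // q; apply: h; exact: measurable_rat_box.
move=> h A mA.
have hq q : (Q : probability V R) (rat_box q) = Q0 (rat_box q).
  by have := h (pickle q) Logic.I; rewrite /= pickleK.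
apply: (@g_sigma_algebra_measure_unique_trace _ R V G setT measurableT) => //.
- by move=> _ [[q _ <-] _]; exact: measurable_rat_box.
- move=> _ _ [[q _ <-] _] [[q' _ <-] _]; rewrite rat_boxI; split => //.
  by exists [ffun i => box_max (q i) (q' i)].
- by rewrite [LHS]probability_setT [RHS]probability_setT.
- by move=> _ [[q _ <-] _]; exact: hq.
- by rewrite [X in (X < _)%E]probability_setT ltry.
- have -> : [set X | G X /\ X `<=` setT] = G.
    by apply/seteqP; split => X //= [].
  exact: measurable_tuple_rat_box.
Qed.

End probability_singletons.

(** * Lower bound *)

Section private_transfer.
Local Open Scope ereal_scope.
Context {d : measure_display} {T : measurableType d} {R : realType}.
Implicit Types P Q : probability T R.

Definition multiplicatively_stable (e : R) {U : Type} (g : U -> R) : Prop :=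
  forall x y, (g x <= e * g y)%R.

(* rho bounds the gain from replacing Q by P in the integral of any function that
   varies by a factor at most e. *)
Definition transfer_rate P Q (e rho : R) : Prop :=
  forall g : T -> R, measurable_fun [set: T] g -> (forall x, (0 <= g x <= 1)%R) ->
    multiplicatively_stable e g ->
    \int[P]_x (g x)%:E <= rho%:E * \int[Q]_x (g x)%:E.

Let mean_bounds Q (e c : R) (g : T -> R) : (0 <= e)%R ->
  measurable_fun [set: T] g -> (forall x, (0 <= g x <= 1)%R) ->
  multiplicatively_stable e g -> \int[Q]_x (g x)%:E = c%:E ->
  forall x, (g x <= e * c)%R /\ (c <= e * g x)%R.
Proof.
move=> e0 mg g01 ge gc x.
have g0 y : 0 <= (g y)%:E by rewrite lee_fin; have /andP[] := g01 y.
have mEg : measurable_fun [set: T] (fun y => (g y)%:E) by exact/measurable_EFinP.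
split; rewrite -lee_fin.
  rewrite EFinM -gc -ge0_integralZl// -(integral_prob_cst Q (g x)%:E).
  apply: ge0_le_integral => //; first exact: measurable_funeM.
  by move=> y _; rewrite -EFinM lee_fin.
rewrite -gc -(integral_prob_cst Q (e * g x)%:E).
by apply: ge0_le_integral => // y _; rewrite lee_fin.
Qed.

Let prob_integral_fin Q (g : T -> R) : measurable_fun [set: T] g ->
  (forall x, (0 <= g x <= 1)%R) -> \int[Q]_x (g x)%:E \is a fin_num.
Proof.
move=> mg g01.
have g1 x : (`|g x| <= 1)%R by have /andP[? ?] := g01 x; rewrite ger0_norm.
exact: (integral_fune_fin_num measurableT (prob_integrable_bounded Q mg g1)).
Qed.

Lemma transfer_rate_trivial P Q (e : R) : (0 <= e)%R -> transfer_rate P Q e e.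
Proof.
move=> e0 g mg g01 ge; have fin := prob_integral_fin Q mg g01.
have gc : \int[Q]_x (g x)%:E = (fine (\int[Q]_x (g x)%:E))%:E by rewrite fineK.
have h := mean_bounds e0 mg g01 ge gc.
rewrite gc -EFinM -[leRHS](integral_prob_cst P).
apply: ge0_le_integral => //.
- by move=> x _; rewrite lee_fin; have /andP[] := g01 x.
- exact/measurable_EFinP.
- by move=> x _; rewrite lee_fin; case: (h x).
Qed.

(** Stability confines [g] to within [c * (e - 1)] of its mean [c]. This deviation is relative to
    [c], so the fluctuation bound becomes a multiplicative factor. *)
Lemma transfer_rate_chi2 P Q (e k : R) : (1 < e)%R -> (0 < k)%R -> (k <= 1)%R ->
  chi2_le P Q (1 + k) -> transfer_rate P Q e (1 + (e - 1) * Num.sqrt k)%R.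
Proof.
move=> e1 k0 k1 PQ g mg g01 ge; have fin := prob_integral_fin Q mg g01.
have e0 : (0 <= e)%R by lra.
have gc : \int[Q]_x (g x)%:E = (fine (\int[Q]_x (g x)%:E))%:E by rewrite fineK.
set c := fine _ in gc.
have h := mean_bounds e0 mg g01 ge gc.
have c0 : (0 <= c)%R.
  by rewrite -lee_fin -gc integral_ge0// => x _; rewrite lee_fin; have /andP[] := g01 x.
(* The fluctuation bound wants a positive deviation; with zero mean, stability forces [g] to vanish
   everywhere. *)
have [c00|cn0] := eqVneq c 0%R.
  rewrite gc c00 mule0 (_ : (fun x => _) = cst 0); last first.
    apply/funext => x /=; congr EFin; apply/eqP.
    rewrite eq_le; have /andP[-> _] := g01 x; rewrite andbT.
    by have [] := h x; rewrite c00 mulr0.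
  by rewrite integral_prob_cst.
have cp : (0 < c)%R by rewrite lt_neqAle eq_sym cn0.
have := @chi2_fluctuation _ T R P Q k (c * (e - 1)) g c PQ k0 k1.
rewrite gc -EFinM (_ : c + c * (e - 1) * Num.sqrt k =
  (1 + (e - 1) * Num.sqrt k) * c)%R; last by ring.
apply => //; first by rewrite mulr_gt0// subr_gt0.
move=> x; rewrite ler_norml; have [h1 h2] := h x.
(* The lower side rests on [1 / e >= 2 - e]. *)
by apply/andP; split; nra.
Qed.

(** Users are exchanged one at a time. Averaging over the other users preserves stability in the
    remaining one, so [G] satisfies the hypotheses of [transfer_rate]. *)
Lemma iid_transfer n P Q (e rho : R) (f : n.-tuple T -> R) :
  (0 <= e)%R -> (0 <= rho)%R ->
  transfer_rate P Q e rho ->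
  measurable_fun [set: n.-tuple T] f -> (forall x, (0 <= f x <= 1)%R) ->
  (forall (i : 'I_n) (x x' : n.-tuple T),
    (forall j, j != i -> tnth x j = tnth x' j) -> (f x <= e * f x')%R) ->
  \int[iid_prob n P]_x (f x)%:E <= (rho ^+ n)%:E * \int[iid_prob n Q]_x (f x)%:E.
Proof.
move=> e0 rho0 PQ; elim: n f => [|n IH] f mf f01 fe.
  by rewrite expr0 mul1e /iid_prob /= lexx.
have mEf : measurable_fun [set: n.+1.-tuple T] (fun x => (f x)%:E).
  exact/measurable_EFinP.
have Ef0 x : 0 <= (f x)%:E by rewrite lee_fin; have /andP[] := f01 x.
rewrite /iid_prob !tuple_prob_integralS// -/(iid_prob n P) -/(iid_prob n Q).
have msec x : measurable_fun [set: n.-tuple T] (fun y => f (tuple_cons (x, y))).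
  by apply: (measurableT_comp mf); exact: measurable_tuple_cons2.
pose G x := fine (\int[iid_prob n Q]_y (f (tuple_cons (x, y)))%:E).
have GE x : (G x)%:E = \int[iid_prob n Q]_y (f (tuple_cons (x, y)))%:E.
  rewrite /G fineK//.
  have f1 y : (`|f (tuple_cons (x, y))| <= 1)%R.
    by have /andP[? ?] := f01 (tuple_cons (x, y)); rewrite ger0_norm.
  exact: (integral_fune_fin_num measurableT
    (prob_integrable_bounded (iid_prob n Q) (msec x) f1)).
have mEG : measurable_fun [set: T] (fun x => (G x)%:E).
  rewrite (_ : (fun x => _) = fun x => \int[iid_prob n Q]_y (f (tuple_cons (x, y)))%:E).
    exact: (measurable_tuple_prob_section (fun=> Q) mEf Ef0).
  by apply/funext => x; exact: GE.
have mG : measurable_fun [set: T] G by exact/measurable_EFinP.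
have G01 x : (0 <= G x <= 1)%R.
  rewrite -!lee_fin GE integral_ge0//= -[leRHS](integral_prob_cst (iid_prob n Q)).
  apply: ge0_le_integral => //; last first.
    by move=> y _; rewrite lee_fin; have /andP[] := f01 (tuple_cons (x, y)).
  by apply/measurable_EFinP; exact: msec.
apply: (@le_trans _ _ (\int[P]_x ((rho ^+ n)%:E * (G x)%:E))).
  apply: ge0_le_integral => //.
  - by move=> x _; exact: integral_ge0.
  - exact: (measurable_tuple_prob_section (fun=> P) mEf Ef0).
  - exact: measurable_funeM.
  - move=> x _; rewrite GE; apply: (IH _ (msec x) (fun y => f01 _)).
    move=> i y y' yy'; apply: (fe (lift ord0 i)) => j ji.
    case: (unliftP ord0 j) ji => [j' ->|->] ji; last by [].
    rewrite !tnth_tuple_consS; apply: yy'.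
    by apply: contra ji => /eqP ->.
rewrite ge0_integralZl//; last 2 first.
- by move=> x _; rewrite lee_fin; have /andP[] := G01 x.
- by rewrite lee_fin exprn_ge0.
rewrite exprSr EFinM -muleA lee_wpmul2l ?lee_fin ?exprn_ge0//.
under [in leRHS]eq_integral do rewrite -GE.
apply: PQ => //.
move=> x x'; rewrite -lee_fin EFinM !GE -ge0_integralZl//; last first.
  by apply/measurable_EFinP; exact: msec.
apply: ge0_le_integral => //.
- by apply/measurable_EFinP; exact: msec.
- by apply/measurable_funeM/measurable_EFinP; exact: msec.
- move=> y _; rewrite -EFinM lee_fin; apply: (fe ord0) => j j0.
  case: (unliftP ord0 j) j0 => [j' ->|->] // _.
  by rewrite !tnth_tuple_consS.
Qed.

End private_transfer.

(** * Packing: Hamming balls and averaging over targets *)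

Section hamming_balls.
Context {d : nat}.
Local Notation J := {ffun 'I_d -> 'I_16}.

Definition hamming (v w : J) : nat := #|[set i | w i != v i]%SET|.

(* Weigh w by 16 ^ (number of agreements with v): a point of the ball has weight
   at least 8 ^ d, while the weights add up to (16 + 15) ^ d. *)
Lemma card_hamming_ball (v : J) :
  (#|[set w : J | 4 * hamming v w <= d]%SET| <= 4 ^ d)%N.
Proof.
pose a i (b : 'I_16) : nat := if b != v i then 1 else 16.
have wE (w : J) : (\prod_(i < d) a i (w i) = 16 ^ (d - hamming v w))%N.
  transitivity (\prod_(i < d | w i == v i) 16)%N.
    by rewrite [RHS]big_mkcond; apply: eq_bigr => i _; rewrite /a; case: eqP.
  rewrite prod_nat_const; congr (_ ^ _)%N.
  have := cardsC [set i | w i != v i]; rewrite card_ord => e.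
  transitivity #|~: [set i | w i != v i]|; last by rewrite /hamming; lia.
  by apply: eq_card => i; rewrite !inE negbK.
have tot : (\sum_(w : J) \prod_(i < d) a i (w i) = 31 ^ d)%N.
  rewrite -(bigA_distr_bigA (fun i b => a i b)) -[X in (_ ^ X)%N](card_ord d).
  rewrite -prod_nat_const; apply: eq_bigr => i _.
  rewrite (bigD1 (v i))//= {1}/a eqxx /=.
  rewrite (eq_bigr (fun=> 1%N)); last by move=> b bv; rewrite /a bv.
  rewrite sum1_card -[X in (_ + X)%N]/(#|predC1 (v i)|) cardC1 card_ord.
  by [].
have key : (#|[set w : J | 4 * hamming v w <= d]%SET| * 8 ^ d <= 31 ^ d)%N.
  rewrite -tot -sum_nat_const.
  apply: (@leq_trans (\sum_(w in [set w : J | 4 * hamming v w <= d]%SET)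
    \prod_(i < d) a i (w i))%N).
    apply: leq_sum => w; rewrite inE wE => hw.
    rewrite -[8%N]/(2 ^ 3)%N -[16%N]/(2 ^ 4)%N -!expnM leq_exp2l// mulnBr.
    by rewrite leq_subRL; lia.
  rewrite big_mkcond /=; apply: leq_sum => w _; case: ifP => //.
(* What remains is [31 ^ d <= (4 * 8) ^ d]. *)
rewrite -(@leq_pmul2r (8 ^ d))%N ?expn_gt0// (leq_trans key)// -expnMn.
by elim: (d) => // k ih; rewrite !expnS leq_mul.
Qed.

End hamming_balls.

Section packing.
Local Open Scope ereal_scope.
Context {R : realType}.

Lemma sum_prob_le_multiplicity {d : measure_display} {Y : measurableType d}
    (nu : {measure set Y -> \bar R}) (J : finType) (E : J -> set Y) (B : nat) :
  nu [set: Y] = 1 -> (forall v, measurable (E v)) ->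
  (forall y, (#|[set v | y \in E v]%SET| <= B)%N) ->
  \sum_(v : J) nu (E v) <= B%:R%:E.
Proof.
move=> nu1 mE hB.
apply: (@le_trans _ _ (\sum_(v : J) \int[nu]_y (\1_(E v) y)%:E)).
  by apply: lee_sum => v _; rewrite integral_indic// setIT.
rewrite -ge0_integral_sum//; last first.
  by move=> v; apply/measurable_EFinP; exact: measurable_indic.
apply: (@le_trans _ _ (\int[nu]_y B%:R%:E)); last first.
  by rewrite integral_cst// nu1 mule1.
apply: ge0_le_integral => //.
- by move=> y _; apply: sume_ge0 => v _; rewrite lee_fin indicE.
- apply: emeasurable_sum => v; apply/measurable_EFinP; exact: measurable_indic.
- move=> y _; rewrite sumEFin lee_fin -natr_sum ler_nat.
  apply: leq_trans (hB y); rewrite -sum1_card [leqRHS]big_mkcond /=.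
  by apply: leq_sum => v _; rewrite inE; case: (y \in E v).
Qed.

(** Averaging: each output counts for at most [B] targets, so the probabilities of all targets add
    up to at most [B]. *)
Lemma exists_small_prob {dX dY : measure_display} {X : measurableType dX}
    {Y : measurableType dY} (P : probability X R) (A : R.-pker X ~> Y)
    (J : finType) (E : J -> set Y) (B : nat) : (0 < #|J|)%N ->
  (forall v, measurable (E v)) ->
  (forall y, (#|[set v | y \in E v]%SET| <= B)%N) ->
  exists v, \int[P]_x A x (E v) <= (B%:R / #|J|%:R)%:E.
Proof.
move=> J0 mE hB.
have mA v : measurable_fun [set: X] (fun x => A x (E v)).
  exact: measurable_kernel.
have sumB : \sum_(v : J) \int[P]_x A x (E v) <= B%:R%:E.
  rewrite -ge0_integral_sum// -[leRHS](integral_prob_cst P).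
  apply: ge0_le_integral => //.
  - by move=> x _; apply: sume_ge0.
  - exact: emeasurable_sum.
  - by move=> x _; apply: sum_prob_le_multiplicity => //; exact: prob_kernel.
apply: contrapT => hex.
have hlt v : (B%:R / #|J|%:R)%:E < \int[P]_x A x (E v).
  by rewrite ltNge; apply/negP => h; apply: hex; exists v.
have fin v : \int[P]_x A x (E v) \is a fin_num.
  rewrite ge0_fin_numE ?integral_ge0// (@le_lt_trans _ _ B%:R%:E) ?ltry//.
  apply: le_trans sumB; rewrite (bigD1 v)//= leeDl// sume_ge0// => w _.
  exact: integral_ge0.
move: sumB; rewrite leNgt => /negP; apply.
under eq_bigr do rewrite -(fineK (fin _)).
rewrite sumEFin lte_fin.
apply: (@le_lt_trans _ _ (\sum_(v : J) B%:R / #|J|%:R)%R).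
  by rewrite sumr_const -[leRHS]mulr_natr divfK// pnatr_eq0 -lt0n.
apply: ltr_sum => [|v _]; last by rewrite -lte_fin fineK.
by case/card_gt0P: J0 => v _; apply/hasP; exists v => //; rewrite mem_index_enum.
Qed.

End packing.

(** * The three lower bounds on the number of users *)

Section lower_bound.
Context {R : realType}.
Variables (d m n : nat) (r alpha eps : R).
Variable b : R.
Hypotheses (d0 : (0 < d)%N) (a0 : 0 < alpha) (bE : b = 80 * alpha)
  (bc : 15 * b <= 1) (br : 15 * b <= r) (e0 : 0 < eps) (e1 : eps <= 2^-1)
  (m0 : (0 < m)%N).
Local Notation V := (d.-tuple (measurableTypeR R)).
Local Notation J := {ffun 'I_d -> 'I_16}.
Variable A : R.-pker (n.-tuple (m.-tuple V)) ~> (pprobability V R).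
Hypotheses (DP : user_level_DP eps 0 A) (sol : solves (Gauss r d alpha) A).

(** One step in all [d] coordinates covers the distance [b]. Centres sharing a correct output are
    within [40 * alpha = b / 2], hence differ in at most [d / 4] coordinates, the radius of
    [card_hamming_ball]. All centres lie within [15 * b] of each other and of the origin: the
    separation needs this to be at most 1, validity needs it to be at most [r]. *)
Let s : R := b / Num.sqrt d%:R.
Let corner (v : J) : d.-tuple R := [tuple s * (v c)%:R | c < d].

Let b0 : 0 < b. Proof. by rewrite bE; exact: mulr_gt0. Qed.

Let bb0 : 0 <= 15 * b. Proof. exact: mulr_ge0 (ltW b0). Qed.

Let s2 : s ^+ 2 * d%:R = b ^+ 2.
Proof.
rewrite /s exprMn exprVn sqr_sqrtr ?ler0n// divfK// pnatr_eq0.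
by rewrite -lt0n.
Qed.

Let ord16_le15 (i : 'I_16) : (i%:R : R) <= 15.
Proof. by rewrite ler_nat -ltnS. Qed.

Let corner_dist_le v w :
  \sum_(c < d) (tnth (corner v) c - tnth (corner w) c) ^+ 2 <= (15 * b) ^+ 2.
Proof.
have -> : (15 * b) ^+ 2 = \sum_(c < d) (225 * s ^+ 2).
  rewrite sumr_const card_ord -[RHS]mulr_natr -mulrA s2; ring.
apply: ler_sum => c _; rewrite !tnth_mktuple -mulrBr exprMn mulrC ler_wpM2r ?sqr_ge0//.
have := ord16_le15 (v c); have := ord16_le15 (w c).
have := ler0n R (v c); have := ler0n R (w c); nra.
Qed.

Let corner_norm_le v :
  \sum_(c < d) (tnth (corner v) c - tnth (origin d) c) ^+ 2 <= (15 * b) ^+ 2.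
Proof.
have -> : (15 * b) ^+ 2 = \sum_(c < d) (225 * s ^+ 2).
  rewrite sumr_const card_ord -[RHS]mulr_natr -mulrA s2; ring.
apply: ler_sum => c _; rewrite !tnth_mktuple subr0 exprMn mulrC ler_wpM2r ?sqr_ge0//.
have := ord16_le15 (v c); have := ler0n R (v c); nra.
Qed.

Let corner_dist_ge v w :
  s ^+ 2 * (hamming v w)%:R <=
  \sum_(c < d) (tnth (corner v) c - tnth (corner w) c) ^+ 2.
Proof.
rewrite /hamming -sum1_card natr_sum mulr_sumr big_mkcond /=.
apply: ler_sum => c _; rewrite inE !tnth_mktuple -mulrBr.
case: ifP => [wv|_]; last exact: sqr_ge0.
rewrite mulr1 [leRHS]exprMn ler_peMr ?sqr_ge0//.
have : (v c : nat) != w c by rewrite eq_sym.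
rewrite neq_ltn => /orP[h|h].
  have : (v c)%:R + 1 <= (w c)%:R :> R by rewrite natr1 ler_nat.
  nra.
have : (w c)%:R + 1 <= (v c)%:R :> R by rewrite natr1 ler_nat.
nra.
Qed.

Let corner_valid v : l2norm (corner v) <= r.
Proof.
apply: le_trans br; rewrite /l2norm.
rewrite -(ger0_norm bb0) -sqrtr_sqr ler_sqrt ?sqr_ge0//.
apply: le_trans (corner_norm_le v); apply: ler_sum => c _.
by rewrite tnth_origin subr0.
Qed.

Lemma exists_hard_corner : exists (v : J) (E : set (pprobability V R)),
  [/\ measurable E,
  ((2 / 3)%:E <= \int[iid_prob n (iid_prob m (gaussian (corner v)))]_x A x E)%E &
  (\int[iid_prob n (iid_prob m (gaussian (origin d)))]_x A x E <=
    (4 ^- d)%:E)%E].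
Proof.
have /choice[E hE] : forall v : J, exists E : set (pprobability V R),
    [/\ measurable E, E `<=` correct (Gauss r d alpha) (gaussian (corner v)) &
    ((2 / 3)%:E <=
      \int[iid_prob n (iid_prob m (gaussian (corner v)))]_x A x E)%E].
  move=> v; apply: sol; exists (corner v) => //=; exact: corner_valid.
have mE v : measurable (E v) by case: (hE v).
have mult Q : (#|[set v | Q \in E v]%SET| <= 4 ^ d)%N.
  (* Around any one centre [v0] with [Q] in its target, all the others lie in one Hamming ball. *)
  have [->|[v0 v0E]] := set_0Vmem [set v | Q \in E v]%SET; first by rewrite cards0.
  apply: leq_trans (card_hamming_ball v0); apply: subset_leq_card.
  apply/fintype.subsetP => v; rewrite !inE => vE; rewrite !inE in v0E.
  have [_ /(_ Q vE)/= tv _] := hE v; have [_ /(_ Q v0E)/= tv0 _] := hE v0.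
  have h1 : (15 * b) ^+ 2 <= 1.
    exact: exprn_ile1.
  have := tv_gaussian_separation (ltW a0) (le_trans (corner_dist_le v0 v) h1) tv0 tv.
  move=> /(le_trans (corner_dist_ge v0 v)).
  have d0R : (0 : R) < d%:R by rewrite ltr0n.
  rewrite -(ler_pM2r d0R) mulrAC s2 (_ : (40 * alpha) ^+ 2 = b ^+ 2 / 4);
    last by rewrite bE; field.
  move=> h; have b2 : 0 < b ^+ 2 by rewrite exprn_gt0.
  have : (hamming v0 v)%:R <= d%:R / 4 :> R by rewrite -(ler_pM2l b2); lra.
  move=> {}h; have : (4 * hamming v0 v)%:R <= d%:R :> R by rewrite natrM; lra.
  by rewrite ler_nat.
have J0 : (0 < #|{: J}|)%N by rewrite card_ffun !card_ord expn_gt0.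
have [v hv] := exists_small_prob (iid_prob n (iid_prob m (gaussian (origin d)))) A
  J0 mE mult.
exists v, (E v); split; [exact: mE|by case: (hE v)|].
apply: le_trans hv _; rewrite lee_fin card_ffun !card_ord !natrX.
rewrite (_ : 16%:R = 4%:R * 4%:R :> R) ?exprMn; last by rewrite -natrM.
by rewrite invfM mulrA divff ?mul1r// expf_neq0.
Qed.

Let expR_half_le : expR (d%:R / 2) <= 4 / 9 * 4 ^+ d :> R.
Proof.
(* Inverting [1 + x <= expR x] at [- 2^-1] gives only 2, too weak for the case [d = 1]; at [- 4^-1],
   followed by squaring, it gives exactly the required [16 / 9]. *)
have e4 : expR 4^-1 <= 4 / 3 :> R.
  have h := @expR_ge1Dx R (- 4^-1); rewrite expRN in h.
  have ep : 0 < expR 4^-1 :> R by exact: expR_gt0.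
  have -> : 4 / 3 = (1 + - 4^-1 : R)^-1 by field.
  by rewrite -[leLHS]invrK lef_pV2 ?posrE ?invr_gt0//; lra.
have e2 : expR 2^-1 <= 16 / 9 :> R.
  have -> : 2^-1 = 4^-1 + 4^-1 :> R by field.
  rewrite expRD; have := expR_gt0 (4^-1 : R); nra.
rewrite expRM_natl; case: (d) d0 => // k _.
elim: k => [|k ih]; first by rewrite !expr1; lra.
rewrite exprS [4 ^+ _]exprS; have := expR_gt0 (2^-1 : R).
have : 0 < 4 ^+ k.+1 :> R by rewrite exprn_gt0.
move: ih; nra.
Qed.

(** Common end of the three bounds. The threshold [4 / 9] is [(2 / 3) ^ 2], because the chi-square
    argument on the whole data squares the success probability; the two others reach it with room to
    spare. *)
Let dim_le_of_transfer (X : R) : 4 / 9 <= expR X * 4 ^- d -> d%:R / 2 <= X.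
Proof.
rewrite -(ler_expR (d%:R / 2)) ler_pdivlMr ?exprn_gt0// => h.
exact: le_trans expR_half_le h.
Qed.

Let real_kernel E : measurable E -> exists f : n.-tuple (m.-tuple V) -> R,
  [/\ measurable_fun [set: n.-tuple (m.-tuple V)] f,
      forall x, 0 <= f x <= 1, forall x, A x E = (f x)%:E &
      forall (i : 'I_n) (x x' : n.-tuple (m.-tuple V)),
        (forall j, j != i -> tnth x j = tnth x' j) -> f x <= expR eps * f x'].
Proof.
move=> mE; exists (fun x => fine (A x E)).
have A1 x : (A x E <= 1)%E.
  have -> : 1%E = A x [set: pprobability V R] by rewrite prob_kernel.
  by apply: le_measure; rewrite ?inE.
have fin x : A x E \is a fin_num.
  by rewrite ge0_fin_numE// (le_lt_trans (A1 x))// ltry.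
split.
- apply: measurableT_comp => //; exact: measurable_kernel.
- by move=> x; rewrite fine_ge0//= -lee_fin fineK.
- by move=> x; rewrite fineK.
- move=> i x x' xx'; rewrite -lee_fin EFinM !fineK//.
  have := DP (ex_intro _ i xx') mE.
  by rewrite adde0.
Qed.

Let exists_hard_test : exists (v : J) (f : n.-tuple (m.-tuple V) -> R),
  [/\ measurable_fun [set: n.-tuple (m.-tuple V)] f /\ (forall x, 0 <= f x <= 1),
  (forall (i : 'I_n) (x x' : n.-tuple (m.-tuple V)),
     (forall j, j != i -> tnth x j = tnth x' j) -> f x <= expR eps * f x'),
  ((2 / 3)%:E <=
    \int[iid_prob n (iid_prob m (gaussian (corner v)))]_x (f x)%:E)%E &
  (\int[iid_prob n (iid_prob m (gaussian (origin d)))]_x (f x)%:E <=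
    (4 ^- d)%:E)%E].
Proof.
have [v [E [mE hi lo]]] := exists_hard_corner.
have [f [mf f01 fE fe]] := real_kernel mE.
by exists v, f; split => //; under eq_integral do rewrite -fE.
Qed.

(** Group privacy: exchanging all [n] users costs [expR (n * eps)], which must make up for
    [4 ^ d]. *)
Lemma users_ge_privacy : d%:R / 2 <= n%:R * eps.
Proof.
have [v [f [[mf f01] fe hi lo]]] := exists_hard_test.
apply: dim_le_of_transfer; rewrite -lee_fin.
apply: (@le_trans _ _ (2 / 3)%:E); first by rewrite lee_fin; lra.
apply: (le_trans hi).
have tr := transfer_rate_trivial (iid_prob m (gaussian (corner v)))
  (iid_prob m (gaussian (origin d))) (expR_ge0 eps).
apply: (le_trans (iid_transfer (expR_ge0 eps) (expR_ge0 eps) tr mf f01 fe)).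
by rewrite -expRM_natl EFinM lee_wpmul2l ?lee_fin ?expR_ge0.
Qed.

Lemma users_ge_private_samples : (25 * b) ^+ 2 * m%:R <= 1 ->
  d%:R / 2 <= n%:R * (50 * b * eps * Num.sqrt m%:R).
Proof.
move=> small; have [v [f [[mf f01] fe hi lo]]] := exists_hard_test.
(* Taking 25 where the corners only need 15 yields [m * S <= k / 2], and then
   [expR (m * S) <= 1 + k] for [k <= 1]. *)
set k := (25 * b) ^+ 2 * m%:R in small.
have b25 : 0 < 25 * b by exact: mulr_gt0.
have k0 : 0 < k by rewrite mulr_gt0 ?exprn_gt0// ltr0n.
have m0' : 0 <= (m%:R : R) by rewrite ler0n.
have sk : Num.sqrt k = 25 * b * Num.sqrt m%:R.
  by rewrite sqrtrM ?sqr_ge0// sqrtr_sqr ger0_norm//; exact: mulr_ge0 (ltW b0).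
have chi : chi2_le (iid_prob m (gaussian (corner v)))
    (iid_prob m (gaussian (origin d))) (1 + k).
  apply: chi2_leW (chi2_le_iid (n := m) (chi2_le_gaussian (corner v) (origin d))).
  set S := \sum_(c < d) _.
  have S0 : 0 <= S by apply: sumr_ge0 => c _; exact: sqr_ge0.
  have hS : S <= (15 * b) ^+ 2 := corner_norm_le v.
  have mS : m%:R * S <= k / 2 by rewrite /k; nra.
  have mS0 : 0 <= m%:R * S by exact: mulr_ge0.
  have /expR_le_quadratic : m%:R * S <= 2^-1 by lra.
  by move=> /le_trans; apply; nra.
have ee1 : 1 < expR eps by rewrite expR_gt1.
have ee2 : expR eps - 1 <= 2 * eps.
  have : eps ^+ 2 <= eps * 2^-1 by rewrite expr2 ler_wpM2l// ltW.
  by have := expR_le_quadratic e1; lra.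
have tr := transfer_rate_chi2 ee1 k0 small chi.
set rho := 1 + _ in tr.
have q0 : 0 <= Num.sqrt k by exact: sqrtr_ge0.
have rho0 : 0 <= rho by rewrite /rho; nra.
have rhoe : rho <= expR (50 * b * eps * Num.sqrt m%:R).
  apply: le_trans (expR_ge1Dx _); rewrite /rho lerD2l.
  have -> : 50 * b * eps * Num.sqrt m%:R = 2 * eps * Num.sqrt k.
    by rewrite sk; ring.
  by rewrite ler_wpM2r.
apply: dim_le_of_transfer; rewrite -lee_fin.
apply: (@le_trans _ _ (2 / 3)%:E); first by rewrite lee_fin; lra.
apply: (le_trans hi).
apply: (le_trans (iid_transfer (expR_ge0 eps) rho0 tr mf f01 fe)).
rewrite expRM_natl EFinM; apply: lee_pmul.
- by rewrite lee_fin exprn_ge0.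
- by apply: integral_ge0 => x _; rewrite lee_fin; have /andP[] := f01 x.
- by rewrite lee_fin lerXn2r// nnegrE expR_ge0.
- exact: lo.
Qed.

(** Cauchy-Schwarz on the joint law of all [n * m] examples, together with [f ^ 2 <= f]. *)
Lemma users_ge_samples : d%:R / 2 <= n%:R * (m%:R * (15 * b) ^+ 2).
Proof.
have [v [f [[mf f01] fe hi lo]]] := exists_hard_test.
have f0 x : (0 <= (f x)%:E)%E by rewrite lee_fin; have /andP[] := f01 x.
have mEf : measurable_fun [set: n.-tuple (m.-tuple V)] (fun x => (f x)%:E).
  exact/measurable_EFinP.
have chi := chi2_le_iid (n := n) (chi2_le_iid (n := m)
  (chi2_le_gaussian (corner v) (origin d))).
have := chi _ mEf f0.
set S := \sum_(c < d) _ => h.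
have hS : S <= (15 * b) ^+ 2 := corner_norm_le v.
apply: dim_le_of_transfer; rewrite -lee_fin.
apply: (@le_trans _ _ ((2 / 3)%:E * (2 / 3)%:E)%E).
  by rewrite -EFinM lee_fin; lra.
apply: (@le_trans _ _ _ _ _ (lee_pmul _ _ hi hi)); rewrite ?lee_fin//.
apply: (le_trans h); rewrite EFinM; apply: lee_pmul.
- by rewrite lee_fin expR_ge0.
- by apply: integral_ge0 => x _; rewrite mule_ge0.
- rewrite lee_fin ler_expR ler_wpM2l ?ler0n// ler_wpM2l ?ler0n//.
- apply: le_trans lo; apply: ge0_le_integral => //.
  + by move=> x _; rewrite mule_ge0.
  + exact: emeasurable_funM.
  + move=> x _; rewrite -EFinM lee_fin; have /andP[h0 h1] := f01 x.
    by rewrite ler_piMr.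
Qed.

Lemma users_lower_bound :
  d%:R / eps + d%:R / (alpha * eps * Num.sqrt m%:R) + d%:R / (alpha ^+ 2 * m%:R)
  <= (2 + 100 * 80 + 2 * (15 * 80) ^+ 2) * n%:R.
Proof.
have mR : (0 : R) < m%:R by rewrite ltr0n.
have sm : 0 < Num.sqrt (m%:R : R) by rewrite sqrtr_gt0.
have sm2 : Num.sqrt (m%:R : R) ^+ 2 = m%:R by rewrite sqr_sqrtr// ltW.
have h1 : d%:R / eps <= 2 * n%:R.
  by rewrite ler_pdivrMr//; have := users_ge_privacy; lra.
have h3 : d%:R / (alpha ^+ 2 * m%:R) <= 2 * (15 * 80) ^+ 2 * n%:R.
  rewrite ler_pdivrMr ?mulr_gt0 ?exprn_gt0//.
  have := users_ge_samples; rewrite bE => h.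
  rewrite (_ : _ * _ * _ = 2 * (n%:R * (m%:R * (15 * (80 * alpha)) ^+ 2))).
    by lra.
  by ring.
have h2 : d%:R / (alpha * eps * Num.sqrt m%:R) <= 100 * 80 * n%:R.
  have ap : 0 < alpha * eps * Num.sqrt m%:R by rewrite !mulr_gt0.
  have [small|big] := leP ((25 * b) ^+ 2 * m%:R) 1.
    rewrite ler_pdivrMr//; have := users_ge_private_samples small.
    rewrite bE => h.
    rewrite (_ : 100 * 80 * n%:R * _ =
      2 * (n%:R * (50 * (80 * alpha) * eps * Num.sqrt m%:R))); first by lra.
    by ring.
  (* Here [alpha * sqrt m] exceeds [1 / (25 * 80)], so the middle term is at most a constant times
     the first one. *)
  have b25 : 0 < 25 * b by exact: mulr_gt0.
  have big' : 1 < 25 * b * Num.sqrt m%:R.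
    rewrite ltNge; apply/negP => h.
    have := exprn_ile1 2 (mulr_ge0 (ltW b25) (ltW sm)) h.
    by rewrite exprMn sm2 leNgt big.
  apply: (@le_trans _ _ (25 * 80 * (d%:R / eps))); last first.
    by have := ler0n R n; lra.
  rewrite ler_pdivrMr// (_ : 25 * 80 * (d%:R / eps) * _ =
      d%:R * (25 * b * Num.sqrt m%:R)).
    by rewrite ler_peMr// ?ler0n// ltW.
  by rewrite bE; field; rewrite gt_eqF.
by rewrite 2!mulrDl; exact: lerD (lerD h1 h2) h3.
Qed.

End lower_bound.

(** * Upper bound *)

Section mixture_kernel.
Local Open Scope ereal_scope.
Context {R : realType} {dX dY : measure_display} {X : measurableType dX}
  {Y : measurableType dY}.

Lemma exists_mixture_kernel (J : finType) (p : J -> X -> R) (q : J -> Y) :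
  (forall j, measurable_fun [set: X] (p j)) -> (forall j x, (0 <= p j x)%R) ->
  (forall x, (\sum_(j : J) p j x = 1)%R) ->
  exists A : R.-pker X ~> Y, forall x S, A x S = \sum_(j : J) (p j x)%:E * \d_(q j) S.
Proof.
move=> mp p0 p1.
pose mix x (S : set Y) : \bar R := \sum_(j : J) (p j x)%:E * \d_(q j) S.
have mix0 x : mix x set0 = 0.
  by rewrite /mix big1// => j _; rewrite measure0 mule0.
have mix_ge0 x S : 0 <= mix x S.
  by apply: sume_ge0 => j _; rewrite mule_ge0// lee_fin.
have mix_sa x : semi_sigma_additive (mix x).
  move=> F mF tF mUF.
  rewrite [X in X @ \oo --> _](_ : _ = fun n => \sum_(j : J)
      ((p j x)%:E * \sum_(0 <= i < n) \d_(q j) (F i))); last first.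
    apply/funext => n; rewrite exchange_big; apply: eq_bigr => j _.
    by rewrite ge0_sume_distrr.
  apply: cvg_nnesum => [j _|j _].
    apply: nearW => n; rewrite mule_ge0 ?lee_fin//; exact: sume_ge0.
  by apply: cvgeZl => //; exact: measure_semi_sigma_additive.
pose mm x : {measure set Y -> \bar R} :=
  HB.pack (mix x) (isMeasure.Build _ _ _ (mix x) (mix0 x) (mix_ge0 x) (mix_sa x)).
have mker U : measurable U -> measurable_fun [set: X] (mm ^~ U).
  move=> mU; rewrite (_ : mm ^~ U = fun x => \sum_(j : J) (p j x)%:E * \d_(q j) U)//.
  apply: emeasurable_sum => j; apply: emeasurable_funM => //.
  by apply/measurable_EFinP; exact: mp.
pose hk := isKernel.Build _ _ X Y R mm mker.
pose K : R.-ker X ~> Y := HB.pack mm hk.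
have prob1 x : K x [set: Y] = 1.
  rewrite /= /mix; under eq_bigr do rewrite diracT mule1.
  by rewrite sumEFin p1.
pose A : R.-pker X ~> Y := HB.pack mm hk
  (Kernel_isProbability.Build _ _ X Y R K prob1).
by exists A.
Qed.

End mixture_kernel.

(** * The exponential mechanism on pairwise tests *)

Section private_selection.
Context {R : realType} {dU dY : measure_display} {U : measurableType dU}
  {Y : measurableType dY}.
Variables (J : finType) (T : J -> J -> U -> R) (q : J -> Y) (n : nat) (eps : R).
Hypotheses (mT : forall j l, measurable_fun [set: U] (T j l))
  (T0 : forall j l u, 0 <= T j l u) (T10 : forall j l u, T j l u <= 10)
  (eps0 : 0 < eps).

Definition score j l (x : n.-tuple U) : R := \sum_(i < n) T j l (tnth x i).

(** One user moves a score by at most 10, hence a weight by a factor at most [expR (eps / 2)]; the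
    normalization costs the same factor again. *)
Let lam := eps / 20.

(* The exponential mechanism for the score max_l (score j l), with the maximum
   replaced by a log-sum-exp: weights then stay smooth and no maximum occurs. *)
Definition weight j x : R := (\sum_(l : J) expR (lam * score j l x))^-1.

Definition selection_prob j x : R := weight j x / \sum_(k : J) weight k x.

Let sumexp_gt0 j x : 0 < \sum_(l : J) expR (lam * score j l x).
Proof.
rewrite (bigD1 j)//=; apply: ltr_pwDl; first exact: expR_gt0.
by apply: sumr_ge0 => l _; exact: expR_ge0.
Qed.

Let weight_gt0 j x : 0 < weight j x.
Proof. by rewrite invr_gt0 sumexp_gt0. Qed.

Let sumweight_gt0 (j : J) x : 0 < \sum_(k : J) weight k x.
Proof.
rewrite (bigD1 j)//=; apply: ltr_pwDl; first exact: weight_gt0.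
by apply: sumr_ge0 => l _; exact: ltW.
Qed.

Let measurable_score j l : measurable_fun [set: n.-tuple U] (score j l).
Proof. exact: (measurable_tuple_sum (fun=> mT j l)). Qed.

Let measurable_invr (f : n.-tuple U -> R) : measurable_fun [set: n.-tuple U] f ->
  (forall x, 0 < f x) -> measurable_fun [set: n.-tuple U] (fun x => (f x)^-1).
Proof.
move=> mf f0.
rewrite (_ : (fun x => _) = fun x => expR (- ln (f x))).
  apply: measurableT_comp => //; apply: measurableT_comp => //.
  by apply: (measurableT_comp (@measurable_ln R)).
by apply/funext => x; rewrite expRN lnK// posrE.
Qed.

Let measurable_weight j : measurable_fun [set: n.-tuple U] (weight j).
Proof.
apply: measurable_invr => [|x]; last exact: sumexp_gt0.
apply: measurable_sum => l; apply: measurableT_comp => //.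
exact: measurable_funM.
Qed.

Let measurable_selection_prob j :
  measurable_fun [set: n.-tuple U] (selection_prob j).
Proof.
apply: measurable_funM => //; apply: measurable_invr => [|x].
  exact: measurable_sum.
exact: (sumweight_gt0 j).
Qed.

Let selection_prob_ge0 j x : 0 <= selection_prob j x.
Proof.
exact: divr_ge0 (ltW (weight_gt0 j x)) (ltW (sumweight_gt0 j x)).
Qed.

Let score_neighbor j l (i : 'I_n) (x x' : n.-tuple U) :
  (forall k, k != i -> tnth x k = tnth x' k) -> score j l x <= score j l x' + 10.
Proof.
move=> h; rewrite /score (bigD1 i)//= [in leRHS](bigD1 i)//=.
rewrite (eq_bigr (fun k => T j l (tnth x' k))); last by move=> k ki; rewrite h.
have := T0 j l (tnth x' i); have := T10 j l (tnth x i); lra.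
Qed.

Let weight_neighbor j (i : 'I_n) (x x' : n.-tuple U) :
  (forall k, k != i -> tnth x k = tnth x' k) ->
  weight j x' <= expR (eps / 2) * weight j x.
Proof.
move=> h; rewrite /weight ler_pdivlMr ?sumexp_gt0// ler_pdivrMl ?sumexp_gt0//.
rewrite mulr_suml; apply: ler_sum => l _; rewrite -expRD ler_expR.
have := score_neighbor j l h; rewrite /lam => h'.
have := ler_wpM2l (ltW eps0) h'; lra.
Qed.

Let selection_neighbor j (i : 'I_n) (x x' : n.-tuple U) :
  (forall k, k != i -> tnth x k = tnth x' k) ->
  selection_prob j x <= expR eps * selection_prob j x'.
Proof.
move=> h; have h' k : k != i -> tnth x' k = tnth x k by move=> /h.
have w1 := weight_neighbor j h'.
have w2 : \sum_(k : J) weight k x' <= expR (eps / 2) * \sum_(k : J) weight k x.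
  by rewrite mulr_sumr; apply: ler_sum => k _; exact: weight_neighbor h.
have s1 := sumweight_gt0 j x; have s2 := sumweight_gt0 j x'.
have e0 := expR_gt0 (eps / 2).
have -> : expR eps = expR (eps / 2) * expR (eps / 2).
  by rewrite -expRD; congr expR; field.
rewrite /selection_prob mulrA ler_pdivrMr// mulrAC ler_pdivlMr//.
have := ler_pM (ltW (weight_gt0 j x)) (ltW s2) w1 w2.
by move=> /le_trans; apply; rewrite le_eqVlt; apply/orP; left; apply/eqP; ring.
Qed.

(** [weight j] is bounded through its test against [j0] alone, the normalization through the
    candidate [j0] alone. The rate [t] stays free below [lam] because the moment estimate needs it
    small compared with the margin of the tests, which may be far below [eps]. *)
Let selection_prob_le (t : R) j j0 x : 0 <= t -> t <= lam ->
  selection_prob j x <=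
  \sum_(l : J) expR (t * (score j0 l x - score j j0 x)).
Proof.
move=> t0 tlam.
have p1 : selection_prob j x <= 1.
  rewrite ler_pdivrMr ?(sumweight_gt0 j)// mul1r (bigD1 j)//= lerDl.
  by apply: sumr_ge0 => l _; exact: ltW.
have pr : selection_prob j x <=
    \sum_(l : J) expR (lam * (score j0 l x - score j j0 x)).
  have w1 : weight j x <= expR (- (lam * score j j0 x)).
    rewrite expRN lef_pV2 ?posrE ?expR_gt0// (bigD1 j0)//= lerDl.
    by apply: sumr_ge0 => l _; exact: expR_ge0.
  have w2 : (\sum_(k : J) weight k x)^-1 <= \sum_(l : J) expR (lam * score j0 l x).
    rewrite -[leRHS]invrK lef_pV2 ?posrE ?invr_gt0//; last exact: (sumweight_gt0 j).
    rewrite [leRHS](bigD1 j0)//= lerDl.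
    by apply: sumr_ge0 => l _; exact: ltW.
  apply: (@le_trans _ _ (expR (- (lam * score j j0 x)) *
      \sum_(l : J) expR (lam * score j0 l x))).
    apply: ler_pM => //; first exact: ltW.
    by rewrite invr_ge0 ltW// (sumweight_gt0 j).
  rewrite mulr_sumr; apply: ler_sum => l _; rewrite -expRD ler_expR; lra.
(* either all exponents are negative, and lowering the rate only increases them,
   or one of them is nonnegative and the bound exceeds 1 *)
have [[l hl]|neg] := pselect (exists l, 0 <= score j0 l x - score j j0 x).
  apply: (le_trans p1); rewrite (bigD1 l)//=.
  apply: (@le_trans _ _ (expR (t * (score j0 l x - score j j0 x)))).
    by rewrite -[leLHS]expR0 ler_expR mulr_ge0.
  by rewrite lerDl; apply: sumr_ge0 => k _; exact: expR_ge0.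
apply: (le_trans pr); apply: ler_sum => l _; rewrite ler_expR.
have : score j0 l x - score j j0 x <= 0.
  by rewrite leNgt; apply/negP => h; apply: neg; exists l; exact: ltW.
move=> h; nra.
Qed.

Lemma exists_private_selection (j1 : J) : exists A : R.-pker (n.-tuple U) ~> Y,
  (forall (i : 'I_n) (x x' : n.-tuple U),
    (forall k, k != i -> tnth x k = tnth x' k) ->
    forall S, measurable S -> (A x S <= (expR eps)%:E * A x' S)%E) /\
  forall (t : R) (j0 : J) (S : set Y) (x : n.-tuple U), 0 <= t -> t <= eps / 20 ->
    (A x S <= \sum_(j | `[< S (q j) >])
       (\sum_(l : J) expR (t * (score j0 l x - score j j0 x)))%:E)%E.
Proof.
have p1 x : \sum_(j : J) selection_prob j x = 1.
  by rewrite -mulr_suml divff// gt_eqF// (sumweight_gt0 j1).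
have [A AE] := exists_mixture_kernel q measurable_selection_prob
  selection_prob_ge0 p1.
exists A; split.
  move=> i x x' h S mS; rewrite !AE ge0_sume_distrr; last first.
    by move=> j _; rewrite mule_ge0 ?lee_fin ?selection_prob_ge0.
  apply: lee_sum => j _; rewrite muleA; apply: lee_wpmul2r => //.
  by rewrite -EFinM lee_fin; exact: selection_neighbor h.
move=> t j0 S x t0 tl; rewrite AE [leRHS]big_mkcond /=.
apply: lee_sum => j _; rewrite diracE; case: asboolP => h.
  by rewrite mem_set// mule1 lee_fin; exact: selection_prob_le.
by rewrite memNset// mule0.
Qed.

End private_selection.

(** * Exponential moments of score differences *)

Section selection_utility.
Local Open Scope ereal_scope.
Context {R : realType} {dU : measure_display} {U : measurableType dU}.
Variable P : probability U R.

(** Second-order expansion: the difference is at most 10 in absolute value, so the quadratic term is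
    at most [200 * t ^ 2], and [400 * t <= g] makes it at most half of the linear gain [t * g]. *)
Lemma expR_diff_mean_le (T1 T2 : U -> R) (g t : R) (a1 a2 : R) :
  measurable_fun [set: U] T1 -> measurable_fun [set: U] T2 ->
  (forall u, 0 <= T1 u <= 10)%R -> (forall u, 0 <= T2 u <= 10)%R ->
  a1%:E <= \int[P]_u (T1 u)%:E -> \int[P]_u (T2 u)%:E <= a2%:E ->
  (g <= a1 - a2)%R -> (0 <= t)%R -> (20 * t <= 1)%R -> (400 * t <= g)%R ->
  \int[P]_u (expR (t * (T2 u - T1 u)))%:E <= (expR (- (t * g / 2)))%:E.
Proof.
move=> mT1 mT2 h1 h2 ha1 ha2 hg t0 t20 t400.
have m1 : measurable_fun [set: U] (fun u => (T1 u)%:E) by exact/measurable_EFinP.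
have m2 : measurable_fun [set: U] (fun u => (T2 u)%:E) by exact/measurable_EFinP.
have p1 u : 0 <= (T1 u)%:E by rewrite lee_fin; have /andP[] := h1 u.
have p2 u : 0 <= (T2 u)%:E by rewrite lee_fin; have /andP[] := h2 u.
have me : measurable_fun [set: U] (fun u => (expR (t * (T2 u - T1 u)))%:E).
  apply/measurable_EFinP; apply: measurableT_comp => //.
  by apply: measurable_funM => //; exact: measurable_funB.
have pe u : 0 <= (expR (t * (T2 u - T1 u)))%:E by rewrite lee_fin expR_ge0.
have c0 : (0 <= 1 + 200 * t ^+ 2)%R by have := sqr_ge0 t; lra.
(* The mean of [T1] is added on the left instead of subtracted on the right, which keeps every
   integrand nonnegative. *)
have key : \int[P]_u (expR (t * (T2 u - T1 u)))%:E + t%:E * \int[P]_u (T1 u)%:E <=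
    (1 + 200 * t ^+ 2)%:E + t%:E * \int[P]_u (T2 u)%:E.
  rewrite -[X in _ <= X + _](integral_prob_cst P) -!ge0_integralZl//.
  rewrite -!ge0_integralD//; last 4 first.
  - by move=> u _; rewrite mule_ge0.
  - exact: measurable_funeM.
  - by move=> u _; rewrite mule_ge0.
  - exact: measurable_funeM.
  apply: ge0_le_integral => //.
  - by move=> u _; rewrite adde_ge0// mule_ge0.
  - by apply: emeasurable_funD => //; exact: measurable_funeM.
  - by apply: emeasurable_funD => //; exact: measurable_funeM.
  - move=> u _; rewrite -!EFinM -!EFinD lee_fin.
    have /andP[l1 r1] := h1 u; have /andP[l2 r2] := h2 u.
    set z := (T2 u - T1 u)%R.
    have zb : (z ^+ 2 <= 100)%R by rewrite /z; nra.
    have zt : (t * z <= 2^-1)%R by rewrite /z; nra.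
    have := expR_le_quadratic zt; rewrite exprMn => q.
    have tz : (t ^+ 2 * z ^+ 2 <= t ^+ 2 * 100)%R by rewrite ler_wpM2l ?sqr_ge0.
    have e : (t * z = t * T2 u - t * T1 u)%R by rewrite /z mulrBr.
    lra.
have bound (x1 x2 y : \bar R) : 0 <= y -> 0 <= x2 ->
    a1%:E <= x1 -> x2 <= a2%:E -> y + t%:E * x1 <= (1 + 200 * t ^+ 2)%:E + t%:E * x2 ->
    y <= (1 + 200 * t ^+ 2 + t * (a2 - a1))%:E.
  move=> y0 x20 hx1 hx2 h.
  have : y + t%:E * a1%:E <= (1 + 200 * t ^+ 2)%:E + t%:E * a2%:E.
    apply: (@le_trans _ _ (y + t%:E * x1)); first by rewrite leeD2l// lee_wpmul2l.
    by apply: (le_trans h); rewrite leeD2l// lee_wpmul2l.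
  by case: y y0 {h} => [y| |] //= _; rewrite -?EFinM -?EFinD !lee_fin => h'; lra.
apply: (le_trans (bound _ _ _ _ _ ha1 ha2 key)); try exact: integral_ge0.
rewrite lee_fin; apply: le_trans (expR_ge1Dx _).
have := ler_wpM2l t0 hg; have := ler_wpM2l t0 t400; rewrite expr2; lra.
Qed.

Lemma integral_iid_expR_sum_le n (f : U -> R) (c : R) :
  measurable_fun [set: U] f -> \int[P]_u (expR (f u))%:E <= (expR c)%:E ->
  \int[iid_prob n P]_x (expR (\sum_(i < n) f (tnth x i)))%:E <=
  (expR (n%:R * c))%:E.
Proof.
move=> mf hc; under eq_integral do rewrite expR_sum.
rewrite /iid_prob (integral_tuple_prod (fun=> P) (g := fun _ u => expR (f u))).
- move: hc; have : 0 <= \int[P]_u (expR (f u))%:E.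
    by apply: integral_ge0 => u _; rewrite lee_fin expR_ge0.
  case: (\int[P]_u _) => [I| |] //; rewrite !lee_fin => I0 Ic.
  by rewrite prodEFin lee_fin prodr_const card_ord expRM_natl lerXn2r// nnegrE expR_ge0.
- by move=> _; exact: measurableT_comp.
- by move=> _ u; exact: expR_ge0.
Qed.

End selection_utility.

(** * The grid of candidates and its tests *)

Section grid_selection.
Context {R : realType}.
Variables (d m n : nat) (r alpha eps : R).
Hypotheses (d0 : (0 < d)%N) (m0 : (0 < m)%N) (r0 : 0 < r) (a0 : 0 < alpha)
  (a1 : alpha <= 1) (e0 : 0 < eps) (e1 : eps <= 1).
Local Notation V := (d.-tuple (measurableTypeR R)).

(* Truncating at 1 / alpha discards the precision of large samples that the
   accuracy alpha does not need; the grid below is then fine enough whatever m. *)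
Definition gain : R := Num.min (Num.sqrt m%:R) alpha^-1.

Definition grid_step : R := alpha / 100 / Num.sqrt d%:R.

Definition grid_size : nat := Num.trunc (2 * r / grid_step).

Local Notation J := {ffun 'I_d -> 'I_grid_size.+1}.

Definition grid_point (j : J) : d.-tuple R :=
  [tuple - r + grid_step * (j c)%:R | c < d].

Let sqdist (a b : d.-tuple R) : R := \sum_(c < d) (tnth a c - tnth b c) ^+ 2.

(** A unit vector, except that it is zero when the two points coincide, by the convention
    [0^-1 = 0]. *)
Definition direction (j l : J) (c : 'I_d) : R :=
  (tnth (grid_point l) c - tnth (grid_point j) c) /
  Num.sqrt (sqdist (grid_point l) (grid_point j)).

Definition test (j l : J) (x : m.-tuple V) : R :=
  clip (user_stat (gain / m%:R) (direction j l) (grid_point j) x).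

Let mR : (0 : R) < m%:R. Proof. by rewrite ltr0n. Qed.

Let dR : (0 : R) < d%:R. Proof. by rewrite ltr0n. Qed.

Let sqdist_ge0 a b : 0 <= sqdist a b.
Proof. by apply: sumr_ge0 => c _; exact: sqr_ge0. Qed.

Let step0 : 0 < grid_step.
Proof. by rewrite !divr_gt0// sqrtr_gt0. Qed.

Let step2 : d%:R * grid_step ^+ 2 = (alpha / 100) ^+ 2.
Proof.
rewrite /grid_step [in LHS]exprMn exprVn sqr_sqrtr ?ltW// mulrCA mulfV ?mulr1//.
by rewrite gt_eqF.
Qed.

Let gain_gt0 : 0 < gain.
Proof. by rewrite /gain lt_min sqrtr_gt0 mR invr_gt0 a0. Qed.

Let gain_alpha : gain * alpha <= 1.
Proof.
apply: (@le_trans _ _ (alpha^-1 * alpha)); last by rewrite mulVf// gt_eqF.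
by rewrite ler_wpM2r ?(ltW a0)// /gain ge_min lexx orbT.
Qed.

Let gain2 : gain ^+ 2 <= m%:R.
Proof.
rewrite -(sqr_sqrtr (ltW mR)) lerXn2r ?nnegrE ?sqrtr_ge0 ?(ltW gain_gt0)//.
by rewrite /gain ge_min lexx.
Qed.

Let direction_norm j l : \sum_(c < d) direction j l c ^+ 2 <= 1.
Proof.
rewrite /direction; set S := sqdist _ _.
have S0 : 0 <= S by exact: sqdist_ge0.
under eq_bigr do rewrite exprMn exprVn sqr_sqrtr//.
rewrite -mulr_suml -/(sqdist _ _) -/S.
by have [->|Sn0] := eqVneq S 0; rewrite ?mul0r ?divff.
Qed.

Let direction_scale j l :
  m%:R * ((gain / m%:R) ^+ 2 * \sum_(c < d) direction j l c ^+ 2) <= 1.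
Proof.
have := direction_norm j l; set S := \sum_(c < d) _ => S1.
have -> : m%:R * ((gain / m%:R) ^+ 2 * S) = gain ^+ 2 * S / m%:R.
  by field; rewrite gt_eqF.
rewrite ler_pdivrMr// mul1r; apply: le_trans gain2.
by rewrite ler_piMr// sqr_ge0.
Qed.

Let gainE : m%:R * (gain / m%:R) = gain.
Proof. by rewrite mulrCA mulfV ?mulr1// gt_eqF. Qed.

Let measurable_test j l : measurable_fun [set: m.-tuple V] (test j l).
Proof.
apply: (measurableT_comp (@measurable_clip R)); exact: measurable_user_stat.
Qed.

Section valid_mean.
Variable mu : d.-tuple R.
Hypothesis mur : l2norm mu <= r.

Lemma exists_near_grid_point : exists j0 : J, forall c,
  0 <= tnth mu c - tnth (grid_point j0) c <= grid_step.
Proof.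
have mu2 : \sum_(c < d) tnth mu c ^+ 2 <= r ^+ 2.
  have S0 : 0 <= \sum_(c < d) tnth mu c ^+ 2.
    by apply: sumr_ge0 => c _; exact: sqr_ge0.
  rewrite -(sqr_sqrtr S0) lerXn2r ?nnegrE ?sqrtr_ge0 ?(ltW r0)//.
have bnd c : - r <= tnth mu c <= r.
  rewrite -ler_norml -[leLHS]ger0_norm// -(@ler_pXn2r _ 2)// ?nnegrE ?(ltW r0)//.
  rewrite normr_id real_normK ?num_real//; apply: le_trans mu2.
  by rewrite (bigD1 c)//= lerDl sumr_ge0// => i _; exact: sqr_ge0.
have pos c : 0 <= (tnth mu c + r) / grid_step.
  by have /andP[h1 h2] := bnd c; apply: divr_ge0 (ltW step0); lra.
pose k c := Num.trunc ((tnth mu c + r) / grid_step).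
have kL c : (k c < grid_size.+1)%N.
  rewrite -(ltr_nat R); have /andP[kc _] := truncn_itv (pos c).
  apply: (le_lt_trans kc); apply: (le_lt_trans _ (truncnS_gt _)).
  by rewrite ler_wpM2r ?invr_ge0 ?(ltW step0)//; have /andP[h1 h2] := bnd c; lra.
exists [ffun c => Ordinal (kL c)] => c; rewrite tnth_mktuple ffunE /=.
have /andP[h1 h2] := truncn_itv (pos c).
rewrite ler_pdivlMr// in h1; rewrite ltr_pdivrMr// -natr1 in h2.
rewrite -/(k c) in h1 h2; apply/andP; split; nra.
Qed.

Let good (j : J) : Prop :=
  (tv_dist (gaussian (grid_point j)) (gaussian mu) <= alpha%:E)%E.

Section near.
Variable j0 : J.
Hypothesis hj0 : forall c, 0 <= tnth mu c - tnth (grid_point j0) c <= grid_step.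

Let near_dist : sqdist mu (grid_point j0) <= (alpha / 100) ^+ 2.
Proof.
rewrite -step2 mulr_natl -[d in _ *+ d]card_ord -sumr_const.
apply: ler_sum => c _; have /andP[h1 h2] := hj0 c.
by rewrite lerXn2r ?nnegrE// (le_trans h1).
Qed.

(** Cauchy-Schwarz in arithmetic-geometric form with weight [e]; the sign [s] covers both signs of
    the inner product. *)
Let inner_le j l (s : R) : s ^+ 2 = 1 ->
  s * \sum_(c < d) direction j l c * (tnth mu c - tnth (grid_point j0) c)
  <= alpha / 100.
Proof.
move=> s1; set e := alpha / 100.
have ep : 0 < e by rewrite divr_gt0.
apply: (@le_trans _ _ (\sum_(c < d) (e * direction j l c ^+ 2 +
    (tnth mu c - tnth (grid_point j0) c) ^+ 2 / e) / 2)).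
  rewrite mulr_sumr; apply: ler_sum => c _.
  set a := direction j l c; set b := tnth mu c - _.
  rewrite -subr_ge0.
  have -> : (e * a ^+ 2 + b ^+ 2 / e) / 2 - s * (a * b) =
      ((e * a - s * b) ^+ 2 + (1 - s ^+ 2) * b ^+ 2) / (2 * e).
    by field; rewrite gt_eqF.
  by rewrite s1 subrr mul0r addr0 divr_ge0 ?sqr_ge0// mulr_ge0// ltW.
rewrite -mulr_suml big_split /= -mulr_sumr -mulr_suml -/(sqdist _ _).
rewrite ler_pdivrMr// mulr2n mulrDr mulr1; apply: lerD.
  by rewrite ler_piMr ?direction_norm// ltW.
by rewrite ler_pdivrMr// -expr2; exact: near_dist.
Qed.

Let bad_far j : ~ good j -> (alpha / 3) ^+ 2 <= sqdist (grid_point j0) (grid_point j).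
Proof.
move=> bad; have far : alpha ^+ 2 / 4 < sqdist (grid_point j) mu.
  by rewrite ltNge; apply/negP => h; apply: bad; exact: tv_gaussian_le.
(* The triangle inequality for squared distances costs a factor 2, and
   [1 / 8 - 1 / 100 ^ 2 >= 1 / 9]. *)
have tri : sqdist (grid_point j) mu <=
    2 * sqdist mu (grid_point j0) + 2 * sqdist (grid_point j0) (grid_point j).
  rewrite !mulr_sumr -big_split; apply: ler_sum => c _ /=.
  set x := tnth (grid_point j) c; set y := tnth mu c; set z := tnth _ c.
  rewrite -subr_ge0.
  have -> : 2 * (y - z) ^+ 2 + 2 * (z - x) ^+ 2 - (x - y) ^+ 2 =
    (y + x - 2 * z) ^+ 2 by ring.
  exact: sqr_ge0.
have := near_dist; have : 0 < alpha ^+ 2 by rewrite exprn_gt0.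
rewrite !exprMn; lra.
Qed.

(** Along the direction from [j] to [j0] the mean is displaced by the distance of the two points up
    to the rounding error of [j0], and [1 / 3 - 1 / 100 >= 1 / 4]. Clipping then keeps half of the
    shift. *)
Lemma test_far_mean j : ~ good j ->
  ((5 + gain * alpha / 4 / 2)%:E <=
   \int[iid_prob m (gaussian mu)]_x (test j j0 x)%:E)%E.
Proof.
move=> bad; have ga0 : 0 <= gain * alpha by exact: mulr_ge0 (ltW _) (ltW a0).
apply: user_stat_clip_ge; [exact: direction_scale|lra|have := gain_alpha; lra|].
rewrite gainE -mulrA ler_wpM2l ?(ltW gain_gt0)//.
have S2 := bad_far bad.
set S := sqdist (grid_point j0) (grid_point j) in S2.
have S0 : 0 < S by apply: lt_le_trans S2; rewrite exprn_gt0// divr_gt0.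
have rho : alpha / 3 <= Num.sqrt S.
  rewrite -(@ger0_norm _ (alpha / 3)); last by rewrite divr_ge0// ltW.
  by rewrite -sqrtr_sqr ler_sqrt// ltW.
have self : \sum_(c < d) direction j j0 c *
    (tnth (grid_point j0) c - tnth (grid_point j) c) = Num.sqrt S.
  transitivity (S / Num.sqrt S).
    by rewrite /S mulr_suml; apply: eq_bigr => c _; rewrite mulrC /direction expr2 mulrA.
  by rewrite -[X in X / _](sqr_sqrtr (ltW S0)) expr2 mulfK// gt_eqF// sqrtr_gt0.
have s1 : (-1) ^+ 2 = 1 :> R by rewrite sqrrN expr1n.
have := inner_le j j0 s1; rewrite mulN1r => inner.
have -> : \sum_(c < d) direction j j0 c * (tnth mu c - tnth (grid_point j) c) =
    Num.sqrt S +
    \sum_(c < d) direction j j0 c * (tnth mu c - tnth (grid_point j0) c).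
  by rewrite -self -big_split; apply: eq_bigr => c _ /=; ring.
have gen (x y : R) :
    0 <= alpha / 100 + x -> alpha / 3 <= y -> alpha / 4 <= y + x.
  by have := a0; lra.
by apply: gen rho; rewrite -(opprK (\sum_(c < d) _)) subr_ge0.
Qed.

Lemma test_near_mean l :
  (\int[iid_prob m (gaussian mu)]_x (test j0 l x)%:E <=
   (5 + gain * (alpha / 100))%:E)%E.
Proof.
apply: user_stat_clip_le; first exact: direction_scale.
  by rewrite mulr_ge0 ?(ltW gain_gt0)// divr_ge0// ltW.
rewrite gainE ler_wpM2l ?(ltW gain_gt0)//.
by have := inner_le j0 l (expr1n _ 2); rewrite mul1r.
Qed.

End near.

End valid_mean.

(** [gain * alpha / 10] is the margin between [test_far_mean] and [test_near_mean], as
    [1 / 8 - 1 / 100 >= 1 / 10]. The first entry of the minimum is the cap set by privacy, the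
    second the condition [400 * t <= g] of [expR_diff_mean_le]. *)
Let rate : R := Num.min (eps / 20) (gain * alpha / 10 / 400).

(** The term with factor 2 in front of the logarithm pays for the union over ordered pairs of
    candidates; the summand 2 leaves a failure probability of at most [expR (- 2) <= 1 / 3]. *)
Lemma exists_grid_algorithm :
  2 * ln #|{: J}|%:R + 2 <= n%:R * (rate * (gain * alpha / 10) / 2) ->
  exists A : R.-pker (n.-tuple (m.-tuple V)) ~> (pprobability V R),
    user_level_DP eps 0 A /\ solves (Gauss r d alpha) A.
Proof.
move=> hn.
pose q j : pprobability V R := gaussian (grid_point j).
have T0 j l x : 0 <= test j l x by exact: clip_ge0.
have T10 j l x : test j l x <= 10 by exact: clip_le10.
have [A [ADP Aut]] := exists_private_selection q n measurable_test T0 T10 e0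
  [ffun=> ord0].
exists A; split.
  by move=> x x' [i h] S mS; rewrite adde0; exact: ADP h S mS.
move=> _ [mu mur <-].
have [j0 hj0] := exists_near_grid_point mur.
pose good j := (tv_dist (gaussian (grid_point j)) (gaussian mu) <= alpha%:E)%E.
(* Membership in the total variation ball involves uncountably many events. The finite union of the
   classes of good grid points is measurable and contains every good output of the mechanism. *)
pose E := \bigcup_(j in [set j : J | good j]) [set Q : pprobability V R |
  forall B, measurable B -> (Q : probability V R) B = q j B].
have mE : measurable E.
  by apply: fin_bigcup_measurable => // j _; exact: measurable_eq_prob.
exists E; split => //.
  move=> Q [j gj QE] /=.
  have -> : tv_dist (Q : probability V R) (gaussian mu) =
      tv_dist (gaussian (grid_point j)) (gaussian mu); last exact: gj.
  congr ereal_sup; apply/seteqP; split => _ [B mB <-]; exists B => //.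
    by rewrite QE.
  by rewrite QE.
set P := iid_prob m (gaussian mu).
have ga0 : 0 < gain * alpha by exact: mulr_gt0.
have rate0 : 0 <= rate.
  have p1 : 0 <= eps / 20 by have := e0; lra.
  have p2 : 0 <= gain * alpha / 10 / 400 by lra.
  by rewrite /rate le_min p1 p2.
have rate1 : rate <= eps / 20 by rewrite ge_min lexx.
have rate2 : rate <= gain * alpha / 10 / 400 by rewrite ge_min lexx orbT.
pose f j l u := rate * (test j0 l u - test j j0 u).
have mf j l : measurable_fun [set: m.-tuple V] (f j l).
  by apply: measurable_funM => //; exact: measurable_funB.
have fsum j l (x : n.-tuple (m.-tuple V)) :
    rate * (score test j0 l x - score test j j0 x) = \sum_(i < n) f j l (tnth x i).
  by rewrite /score -sumrB mulr_sumr.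
have hf j l : ~ good j -> (\int[iid_prob n P]_x
    (expR (\sum_(i < n) f j l (tnth x i)))%:E <=
    (expR (- (n%:R * (rate * (gain * alpha / 10) / 2))))%:E)%E.
  move=> bad; rewrite -mulrN; apply: integral_iid_expR_sum_le => //.
  apply: (expR_diff_mean_le (measurable_test j j0) (measurable_test j0 l) _ _
    (test_far_mean hj0 bad) (test_near_mean hj0 l)) => //.
  - by move=> u; rewrite T0 T10.
  - by move=> u; rewrite T0 T10.
  - by have := e1; lra.
  - by have := e1; lra.
  - by have := e1; lra.
have mexp j l : measurable_fun [set: n.-tuple (m.-tuple V)]
    (fun x => (expR (\sum_(i < n) f j l (tnth x i)))%:E).
  apply/measurable_EFinP; apply: measurableT_comp => //.
  exact: (measurable_tuple_sum (fun=> mf j l)).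
have mA S : measurable S -> measurable_fun [set: n.-tuple (m.-tuple V)] (A ^~ S).
  by move=> mS; exact: measurable_kernel.
have J0 : (0 : R) < #|{: J}|%:R.
  by rewrite ltr0n; apply/card_gt0P; exists j0.
have fail : (\int[iid_prob n P]_x A x (~` E) <= (3^-1)%:E)%E.
  pose bads := [seq j <- index_enum {: J} | `[< (~` E) (q j) >]].
  apply: (@le_trans _ _ (\int[iid_prob n P]_x (\sum_(j <- bads)
      \sum_(l : J) (expR (\sum_(i < n) f j l (tnth x i)))%:E)%E)%E).
    apply: ge0_le_integral => //.
    - by apply: mA; exact: measurableC.
    - by apply: emeasurable_sum => j; apply: emeasurable_sum => l.
    - move=> x _; apply: (le_trans (Aut rate j0 (~` E) x rate0 rate1)).
      rewrite big_filter; apply: lee_sum => j _; rewrite sumEFin lee_fin; apply: ler_sum => l _.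
      by rewrite fsum.
  rewrite ge0_integral_sum//; last 2 first.
  - by move=> j; apply: emeasurable_sum.
  - by move=> j x _; apply: sume_ge0 => l _; rewrite lee_fin expR_ge0.
  rewrite big_filter.
  apply: (@le_trans _ _ (\sum_(j | `[< (~` E) (q j) >]) \sum_(l : J)
      (expR (- (n%:R * (rate * (gain * alpha / 10) / 2))))%:E)%E).
    apply: lee_sum => j /asboolP bad.
    rewrite ge0_integral_sum//.
    apply: lee_sum => l _; apply: hf => gj; apply: bad.
    by exists j.
  apply: (@le_trans _ _ (\sum_(j : J) \sum_(l : J)
      (expR (- (n%:R * (rate * (gain * alpha / 10) / 2))))%:E)%E).
    rewrite [leLHS]big_mkcond; apply: lee_sum => j _; case: ifP => // _.
    by apply: sume_ge0 => l _; rewrite lee_fin expR_ge0.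
  have sum_cst (a : R) :
      (\sum_(j : J) \sum_(l : J) a%:E)%E = (a * #|{: J}|%:R * #|{: J}|%:R)%:E.
    under eq_bigr do rewrite sumEFin sumr_const -(mulr_natr a).
    by rewrite sumEFin sumr_const -(mulr_natr (a * _)).
  rewrite sum_cst lee_fin.
  set N := #|{: J}|%:R in J0 hn *.
  have -> : N = expR (ln N) by rewrite lnK// posrE.
  rewrite -!expRD.
  apply: (@le_trans _ _ (expR (- 2))); first by rewrite ler_expR; lra.
  rewrite expRN lef_pV2 ?posrE ?expR_gt0//.
  by have := @expR_ge1Dx R 2; lra.
have tot : (\int[iid_prob n P]_x A x E + \int[iid_prob n P]_x A x (~` E) = 1)%E.
  rewrite -ge0_integralD//; [|exact: mA|by apply: mA; exact: measurableC].
  rewrite -[RHS](integral_prob_cst (iid_prob n P)); apply: eq_integral => x _.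
  rewrite -measureU//; [|exact: measurableC|exact: setICr].
  by rewrite setUv; exact: prob_kernel.
have : (0 <= \int[iid_prob n P]_x A x E)%E by exact: integral_ge0.
have : (0 <= \int[iid_prob n P]_x A x (~` E))%E by exact: integral_ge0.
move: tot fail; move: (\int[iid_prob n P]_x A x E)%E => a.
move: (\int[iid_prob n P]_x A x (~` E))%E => b.
case: a => [a| |]; case: b => [b| |] //.
by rewrite -EFinD => -[ab]; rewrite !lee_fin => h1 h2 h3; lra.
Qed.

End grid_selection.

(** * From the grid to the number of users *)

Section sample_complexity.
Context {R : realType}.

Lemma invr_min_le (x y : R) :
  0 < x -> 0 < y -> (Num.min x y)^-1 <= x^-1 + y^-1.
Proof.
move=> x0 y0; have xV : 0 <= x^-1 by rewrite invr_ge0 ltW.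
have yV : 0 <= y^-1 by rewrite invr_ge0 ltW.
by rewrite /Num.min; case: ifP => _; lra.
Qed.

Lemma ln_ge1 (x : R) : 4 <= x -> 1 <= ln x.
Proof.
move=> x4; rewrite -[leLHS]expRK ler_ln ?posrE ?expR_gt0//; last by lra.
have h : (2^-1 : R) <= expR (- 2^-1).
  by apply: le_trans (expR_ge1Dx _); lra.
have e2 : expR (2^-1 : R) <= 2.
  by rewrite -[leLHS]invrK -expRN -[leRHS]invrK lef_pV2 ?posrE ?expR_gt0.
have -> : (1 : R) = 2^-1 + 2^-1 by lra.
have := expR_gt0 (2^-1 : R); rewrite expRD => e0.
by apply: (le_trans (ler_pM (ltW e0) (ltW e0) e2 e2)); lra.
Qed.

Variables (d m : nat) (r alpha eps : R).
Hypotheses (d0 : (0 < d)%N) (m0 : (0 < m)%N) (r0 : 0 < r) (a0 : 0 < alpha)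
  (a1 : alpha <= 1) (e0 : 0 < eps) (e1 : eps <= 1).

Let s : R := 2 + (alpha^-1 + d%:R + r).

Let users_rate : R := d%:R / eps + d%:R / (alpha * eps * Num.sqrt m%:R)
  + d%:R / (alpha ^+ 2 * m%:R).

Let d1 : (1 : R) <= d%:R. Proof. by rewrite ler1n. Qed.

Let s_parts : [/\ 4 <= s, r <= s, d%:R <= s & alpha^-1 <= s].
Proof.
have ia : 1 <= alpha^-1 by rewrite invf_ge1.
by have := d1; have := r0; rewrite /s; split; lra.
Qed.

(** The count is of order [r * sqrt d / alpha], at most a constant times [s ^ 3]; since [4 <= s],
    the constant is absorbed into the power, and taking logarithms leaves a multiple of [ln s]. *)
Lemma card_grid_le : (grid_size d r alpha).+1%:R <= s ^+ 11.
Proof.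
have [s4 rs ds As] := s_parts.
have s0 : 0 < s by lra.
have s1 : 1 <= s by lra.
have sd : Num.sqrt d%:R <= d%:R :> R.
  rewrite -[leRHS]ger0_norm// -sqrtr_sqr ler_sqrt ?sqr_ge0//.
  by rewrite expr2 ler_peMr.
have pos : 0 <= 2 * r / grid_step d alpha.
  rewrite !divr_ge0 ?mulr_ge0 ?(ltW r0)// ?(ltW a0)// sqrtr_ge0//.
have /andP[h _] := truncn_itv pos.
rewrite -natr1; apply: (@le_trans _ _ (2 * r / grid_step d alpha + 1)).
  by rewrite lerD2r.
have -> : 2 * r / grid_step d alpha = 200 * (r * alpha^-1 * Num.sqrt d%:R).
  rewrite /grid_step; field.
  by rewrite !gt_eqF// sqrtr_gt0 ltr0n.
have p3 : r * alpha^-1 * Num.sqrt d%:R <= s ^+ 3.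
  rewrite exprS expr2 mulrA; apply: ler_pM.
  - by rewrite mulr_ge0 ?(ltW r0)// invr_ge0 ltW.
  - exact: sqrtr_ge0.
  - by apply: ler_pM => //; rewrite ?invr_ge0 ltW.
  - exact: le_trans sd ds.
have s3 : 1 <= s ^+ 3 by rewrite exprn_ege1.
apply: (@le_trans _ _ (4 ^+ 4 * s ^+ 3)); first by rewrite /=; lra.
rewrite (_ : 11 = 8 + 3)%N// exprD ler_wpM2r ?(le_trans _ s3)//.
apply: (@le_trans _ _ (s ^+ 4)); first by rewrite lerXn2r ?nnegrE// ltW.
by rewrite ler_eXn2l//; lra.
Qed.

Lemma ln_card_grid_le :
  ln #|{: {ffun 'I_d -> 'I_(grid_size d r alpha).+1}}|%:R <=
  11 * (d%:R * ln s).
Proof.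
have [s4 _ _ _] := s_parts.
have s0 : 0 < s by lra.
rewrite card_ffun !card_ord natrX lnXn ?ltr0n// -(mulr_natl (ln _) d).
rewrite [leRHS]mulrCA ler_pM2l ?ltr0n// (mulr_natl _ 11) -lnXn//.
by rewrite ler_ln ?posrE ?ltr0n ?exprn_gt0//; exact: card_grid_le.
Qed.

(** With [v = 1 / (alpha * sqrt m)], both minima expand into sums: [1 / t <= v + 1], and the cost is
    of order [(1 / eps + 1 / t) / t]. The cross term of [(v + 1) ^ 2] is split by
    [2 * v <= v ^ 2 + 1], and constants are absorbed by [1 / eps >= 1]. *)
Lemma selection_cost_le :
  (Num.min (eps / 20) (gain m alpha * alpha / 10 / 400) *
    (gain m alpha * alpha))^-1 * d%:R <= 100 * 100 * users_rate.
Proof.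
set t := gain m alpha * alpha; pose q : R := Num.sqrt m%:R.
have q0 : 0 < q by rewrite sqrtr_gt0 ltr0n.
have g0 : 0 < gain m alpha by rewrite /gain lt_min q0 invr_gt0.
have t0 : 0 < t by exact: mulr_gt0.
have tV : t^-1 <= (q * alpha)^-1 + 1.
  rewrite invfM; apply: (@le_trans _ _ ((q^-1 + alpha) * alpha^-1)).
    rewrite ler_pM2r ?invr_gt0//.
    by apply: (le_trans (invr_min_le _ _)); rewrite ?invr_gt0// invrK.
  by rewrite mulrDl mulfV ?gt_eqF// invfM.
rewrite /users_rate -/q.
have -> : m%:R = q ^+ 2 by rewrite sqr_sqrtr.
have eV : 1 <= eps^-1 by rewrite invf_ge1.
have := invr_min_le (divr_gt0 e0 (ltr0Sn R 19))
  (divr_gt0 (divr_gt0 t0 (ltr0Sn R 9)) (ltr0Sn R 399)).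
set w := Num.min _ _ => wV.
have -> : d%:R / eps + d%:R / (alpha * eps * q) + d%:R / (alpha ^+ 2 * q ^+ 2) =
    (eps^-1 * ((q * alpha)^-1 + 1) + (q * alpha)^-1 ^+ 2) * d%:R.
  by field; rewrite !gt_eqF.
rewrite [leRHS]mulrA ler_pM2r ?ltr0n//.
have v0 : 0 < (q * alpha)^-1 by rewrite invr_gt0 mulr_gt0.
have tV0 : 0 < t^-1 by rewrite invr_gt0.
have wV' : w^-1 <= 20 * eps^-1 + 10 * 400 * t^-1.
  apply: (le_trans wV); rewrite !invf_div; lra.
rewrite invfM; move: wV' tV eV v0 tV0; move: w^-1 t^-1 (q * alpha)^-1 eps^-1.
move=> W U v E wV' tV eV v0 U0.
apply: (@le_trans _ _ ((20 * E + 10 * 400 * U) * U)); first by rewrite ler_pM2r.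
have h1 : E * U <= E * (v + 1) by rewrite ler_wpM2l//; lra.
have h2 : U ^+ 2 <= (v + 1) ^+ 2 by rewrite lerXn2r ?nnegrE//; lra.
have h3 : 0 <= (v - 1) ^+ 2 by exact: sqr_ge0.
have h4 : 0 <= E * v by rewrite mulr_ge0//; lra.
have h5 : 0 <= v ^+ 2 by exact: sqr_ge0.
rewrite !sqrrD !expr1n in h2 h3; nra.
Qed.

Lemma users_upper_bound : exists n : nat,
  n%:R <= 100 ^+ 4 * ln s * users_rate /\
  exists A : R.-pker (n.-tuple (m.-tuple (d.-tuple (measurableTypeR R)))) ~>
      (pprobability (d.-tuple (measurableTypeR R)) R),
    user_level_DP eps 0 A /\ solves (Gauss r d alpha) A.
Proof.
have [s4 _ _ _] := s_parts.
have l1 := ln_ge1 s4.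
have cost := selection_cost_le.
set t := gain m alpha * alpha in cost.
have t0 : 0 < t.
  by rewrite mulr_gt0// /gain lt_min sqrtr_gt0 ltr0n m0 invr_gt0 a0.
set w := Num.min (eps / 20) (t / 10 / 400) in cost.
have w0 : 0 < w.
  have p1 : 0 < eps / 20 by have := e0; lra.
  have p2 : 0 < t / 10 / 400 by lra.
  by rewrite /w lt_min p1 p2.
have wt : 0 < w * t by rewrite mulr_gt0.
pose L := ln #|{: {ffun 'I_d -> 'I_(grid_size d r alpha).+1}}|%:R : R.
have Lle : L <= 11 * (d%:R * ln s) := ln_card_grid_le.
have L0 : 0 <= L.
  rewrite ln_ge0// ler1n; apply/card_gt0P; by exists [ffun=> ord0].
(* The factor 20 undoes the [/ 10] of the margin and the [/ 2] of the exponent. *)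
pose X := (2 * L + 2) * 20 * (w * t)^-1.
have X0 : 0 <= X by rewrite !mulr_ge0 ?invr_ge0 ?(ltW wt)//; lra.
exists (Num.trunc X).+1; split.
  (* Rounding up adds at most one user, which is absorbed because [ln s * users_rate] is at least
     1. *)
  have g1 : 1 <= users_rate.
    have h1 : 1 <= d%:R / eps.
      by rewrite ler_pdivlMr// mul1r (le_trans e1).
    have h2 : 0 <= d%:R / (alpha * eps * Num.sqrt m%:R).
      by rewrite divr_ge0// !mulr_ge0 ?sqrtr_ge0 ?(ltW a0) ?(ltW e0).
    have h3 : 0 <= d%:R / (alpha ^+ 2 * m%:R).
      by rewrite divr_ge0// mulr_ge0// sqr_ge0.
    by rewrite /users_rate; lra.
  have /andP[h _] := truncn_itv X0.
  rewrite -natr1; apply: (@le_trans _ _ (X + 1)); first by rewrite lerD2r.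
  have dl : 1 <= d%:R * ln s by rewrite mulr_ege1.
  have h1 : X <= 480 * ln s * ((w * t)^-1 * d%:R).
    rewrite [leRHS](_ : _ = 480 * (d%:R * ln s) * (w * t)^-1); last by ring.
    by rewrite ler_pM2r ?invr_gt0//; lra.
  have h2 : 480 * ln s * ((w * t)^-1 * d%:R) <= 480 * ln s * (100 * 100 * users_rate).
    have l0 : 0 <= 480 * ln s by lra.
    exact: ler_wpM2l l0 _ _ cost.
  have h3 : 1 <= ln s * users_rate by rewrite mulr_ege1.
  move: h1 h2 h3; have -> : 480 * ln s * (100 * 100 * users_rate) =
    480 * 100 ^+ 2 * (ln s * users_rate) by ring.
  rewrite -(mulrA _ (ln s) users_rate).
  move: (ln s * users_rate) (480 * ln s * _) => y z h1 h2 h3.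
  by apply: (@le_trans _ _ (480 * 100 ^+ 2 * y + y)); lra.
apply: exists_grid_algorithm => //; rewrite -/t -/w -/L.
have : X <= (Num.trunc X).+1%:R by exact: ltW (truncnS_gt _).
rewrite /X ler_pdivrMr// => h; lra.
Qed.

End sample_complexity.

Theorem theoremE10 (R : realType) :
  exists (C c : R) (k : nat), 0 < C /\ 0 < c /\
  forall (d : nat) (r alpha eps : R) (m : nat),
    (0 < d)%N -> 0 < r ->
    0 < alpha -> alpha <= c -> alpha <= c * r ->
    0 < eps -> eps <= c ->
    (0 < m)%N ->
    theta_tilde C k (alpha^-1 + d%:R + r)
      (user_complexity (Gauss r d alpha) m eps 0)
      (d%:R / eps + d%:R / (alpha * eps * Num.sqrt m%:R)
       + d%:R / (alpha ^+ 2 * m%:R)).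
Proof.
(* [c] makes the packing radius [15 * 80 * alpha] at most 1 and at most [r]. [C] is the constant of
   the upper bound and exceeds that of the lower bound. The single logarithm is that of the grid
   size. *)
exists (100 ^+ 4), ((15 * 80)^-1), 1%N; split; first by rewrite exprn_gt0.
split; first by rewrite invr_gt0.
move=> d r alpha eps m d0 r0 a0 ac acr e0 ec m0.
have cle : (15 * 80)^-1 <= 2^-1 :> R by rewrite lef_pV2 ?posrE//; lra.
have a1 : alpha <= 1 by lra.
have e12 : eps <= 2^-1 by lra.
have e1 : eps <= 1 by lra.
rewrite /theta_tilde expr1.
have a15 : 15 * (80 * alpha) <= 1.
  rewrite mulrA -[leRHS](@mulfV _ (15 * 80)); last by rewrite gt_eqF.
  by rewrite ler_pM2l.
have ar15 : 15 * (80 * alpha) <= r.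
  rewrite mulrA -[leRHS](@mulVKf _ (15 * 80)); last by rewrite gt_eqF.
  by rewrite ler_pM2l.
have [n0 [n0le sol0]] := users_upper_bound d0 m0 r0 a0 a1 e0 e1.
have l1 : 1 <= ln (2 + (alpha^-1 + d%:R + r)).
  apply: ln_ge1; have : 1 <= alpha^-1 by rewrite invf_ge1.
  by have : (1 : R) <= d%:R; [rewrite ler1n|lra].
split; last first.
  apply: (@le_trans _ _ (n0%:R)%:E); last by rewrite lee_fin.
  by apply: ereal_inf_lbound; exists n0.
apply: le_ereal_inf_tmp => _ [n [A [DP sol]] <-]; rewrite lee_fin.
have low := users_lower_bound d0 a0 erefl a15 ar15 e0 e12 m0 DP sol.
rewrite ler_pdivrMr ?mulr_gt0 ?exprn_gt0//; last by lra.
apply: (le_trans low); rewrite [leRHS]mulrC ler_wpM2r//.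
apply: (@le_trans _ _ (100 ^+ 4)); first by lra.
by rewrite ler_peMr// exprn_ge0.
Qed.
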